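(* There exist constants $\varepsilon > 0$ and $C > 1$ and an integer $n_0$ such that for every odd $n \ge n_0$ the following holds. Let $p \geq C\log n/n$ and $\beta \leq \varepsilon np / \log n$. Then every $(p,\beta)$-jumbled graph $G$ on $n$ vertices with minimum degree $\delta(G) \geq (1-\varepsilon)np$ satisfies $\mathcal{C}_n(G) = \mathcal{C}(G)$.
   Context: Graphs are finite and simple; $\log$ is the natural logarithm. A graph $G$ is $(p,\beta)$-jumbled, where $0 < p < 1 \leq \beta$, if for every $U \subseteq V(G)$ we have $\left| e_G(U) - p\binom{|U|}{2} \right| \leq \beta |U|$, where $e_G(U)$ is the number of edges of $G$ with both endpoints in $U$. For a graph $G=(V,E)$, the edge space $\mathcal{E}(G)$ is the $\mathbb{F}_2$-vector space of all subsets of $E$, with addition given by symmetric difference. The cycle space $\mathcal{C}(G) \subseteq \mathcal{E}(G)$ is the subspace spanned by (the edge sets of) all, not necessarily induced, cycles in $G$. For an integer $k$, $\mathcal{C}_k(G) \subseteq \mathcal{C}(G)$ is the subspace spanned by the edge sets of all cycles in $G$ of length exactly $k$. Thus, if $G$ has $n$ vertices, $\mathcal{C}_n(G)$ is the subspace spanned by the Hamilton cycles of $G$. *)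

(* Defs.v *)
From mathcomp Require Import all_boot all_order all_algebra.
From mathcomp Require Import boolp reals exp.

Set Implicit Arguments.
Unset Strict Implicit.
Unset Printing Implicit Defensive.

Import Order.TTheory GRing.Theory Num.Theory.
Local Open Scope ring_scope.

Record sgraph (V : finType) := SGraph {
  adj : rel V;
  adj_sym : symmetric adj;
  adj_irr : irreflexive adj }.

Section Graph.
Variables (V : finType) (G : sgraph V).

Definition edges : {set {set V}} :=
  [set [set x; y] | x in V, y in V & adj G x y].

Definition num_edges_in (U : {set V}) : nat :=
  #|[set e in edges | e \subset U]|.

Definition degree (v : V) : nat := #|[set w | adj G v w]|.

(* Degrees are below #|V|, so the default value #|V| of the iterated minimum
   is only ever reached on the empty graph. *)
Definition min_degree : nat := \big[minn/#|V|]_(v : V) degree v.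

Definition jumbled (R : realType) (p beta : R) : Prop :=
  [/\ 0 < p < 1, 1 <= beta &
      forall U : {set V},
        `| (num_edges_in U)%:R - p * 'C(#|U|, 2)%:R | <= beta * #|U|%:R].

Definition edge : finType := {e : {set V} | e \in edges}.

(* A set of edges is represented by its characteristic vector, so that
   symmetric difference becomes addition (see edge_vec_symdiff). *)
Definition edge_space := {ffun edge -> ('F_2)^o}.

Definition edge_vec (A : {set {set V}}) : edge_space :=
  [ffun e => (val e \in A)%:R].

Lemma edge_vec_symdiff (A B : {set {set V}}) :
  edge_vec ((A :\: B) :|: (B :\: A)) = edge_vec A + edge_vec B.
Proof.
apply/ffunP => e; rewrite !ffunE !inE.
by case: (_ \in A); case: (_ \in B); apply/val_inj.
Qed.

Lemma edge_vec_inj : {in powerset edges &, injective edge_vec}.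
Proof.
move=> A B; rewrite !inE => sA sB /ffunP eqAB; apply/setP => e.
case eE: (e \in edges); last first.
  by rewrite (contraFF (subsetP sA e) eE) (contraFF (subsetP sB e) eE).
have := eqAB (Sub e eE); rewrite !ffunE SubK.
by case: (_ \in A); case: (_ \in B).
Qed.

Lemma edge_vec_surj (v : edge_space) :
  exists2 A : {set {set V}}, A \subset edges & v = edge_vec A.
Proof.
exists [set val e | e : edge & v e != 0].
  by apply/subsetP => _ /imsetP[e _ ->]; exact: valP.
apply/ffunP => e; rewrite ffunE mem_imset; last exact: val_inj.
by rewrite inE; case: (v e) => -[|[|//]] ?; apply/val_inj.
Qed.

(* The vertices of a cycle in cyclic order. *)
Definition is_cycle (c : seq V) : bool :=
  [&& (2 < size c)%N, uniq c & path.cycle (adj G) c].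

Definition cycle_edges (c : seq V) : {set {set V}} :=
  [set [set x; next c x] | x in c].

Definition cycle_space : {vspace edge_space} :=
  <<[seq v <- enum edge_space |
      `[< exists2 c : seq V, is_cycle c & v = edge_vec (cycle_edges c) >]]>>%VS.

Definition cycle_space_len (k : nat) : {vspace edge_space} :=
  <<[seq v <- enum edge_space |
      `[< exists2 c : seq V, is_cycle c && (size c == k)
                           & v = edge_vec (cycle_edges c) >]]>>%VS.

End Graph.

(* Main.v *)
Require Import Defs.
From mathcomp Require Import all_boot all_order all_algebra.
From mathcomp Require Import boolp reals sequences exp.
From mathcomp Require Import zify lra ring.

Set Implicit Arguments.
Unset Strict Implicit.
Unset Printing Implicit Defensive.

Import Order.TTheory GRing.Theory Num.Theory.

(* Fix a coordinate of the class modulo the span of the Hamilton cycles; it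
   colours the edges by elements of F_2 so that every Hamilton cycle has sum 0,
   and it suffices to write the colour of each edge xy as phi x + phi y, since
   then every cycle has sum 0.

   Split V into robust parts A1, A2, B1, B2 and fix an edge st between A2 and
   B2.  For a in A1 and b in B1 there are a Hamilton path of A1 u A2 from a to s
   and one of B1 u B2 from b to t.  If ab is an edge, the two paths close up to a
   Hamilton cycle, so the colour of ab is the sum of a function of a and a
   function of b.  Hence the colouring is a cut between A1 and B1.  A random
   5-labelling has all its classes robust, even after moving two vertices, and
   comparing the cuts for different groupings of the classes shows that the
   colouring is a cut plus a constant c; as n is odd, a Hamilton cycle gives
   c = 0.

   The Hamilton paths come from Posa rotations.  In a robust set a longest path
   has, after logarithmically many rotations, linearly many possible endpoints.
   Cut it into a logarithmic number of segments: the vertices from which some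
   segment cannot be used for further rotations are few, so both endpoints can
   be chosen outside them.  Few edges have been removed, so two segments are
   still intact; rotating one end through the first and the other end through
   the second gives two large independent sets of endpoints, which are joined by
   an edge, and the path closes to a cycle. *)

(** * Consecutive blocks of a sequence *)

Section Infixes.
Variable T : eqType.
Implicit Types (q s : seq T) (u v x y : T).

Lemma infix_cat_split s q1 q2 : infix s (q1 ++ q2) ->
  [\/ infix s q1, infix s q2
    | exists u s1 s2 v, [/\ s = s1 ++ u :: v :: s2, suffix (rcons s1 u) q1
                          & prefix (v :: s2) q2]].
Proof.
case/infixP=> l [r E].
have [le1|lt1] := leqP (size l + size s) (size q1).
  constructor 1; apply/infixP; exists l, (drop (size l + size s) q1).
  have := congr1 (take (size l + size s)) E.
  rewrite takel_cat // catA -size_cat take_size_cat // => E1.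
  by rewrite catA -[in LHS](cat_take_drop (size (l ++ s)) q1) E1.
have [le2|lt2] := leqP (size q1) (size l).
  constructor 2; apply/infixP; exists (drop (size q1) l), r.
  have := congr1 (drop (size q1)) E; rewrite drop_size_cat // drop_cat.
  case: ltnP => // le2'; have -> : size q1 = size l by apply/eqP; rewrite eqn_leq le2.
  by rewrite subnn drop0 drop_size.
constructor 3; set k := size q1 - size l.
have k0 : 0 < k by rewrite subn_gt0.
have ks : k < size s by rewrite ltn_subLR // ltnW.
have E1 : q1 = l ++ take k s.
  have := congr1 (take (size q1)) E.
  by rewrite take_size_cat // take_cat ltnNge (ltnW lt2) /= takel_cat // ltnW.
have E2 : q2 = drop k s ++ r.
  have := congr1 (drop (size q1)) E.
  by rewrite drop_size_cat // drop_cat ltnNge (ltnW lt2) /= drop_cat ks.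
have : 0 < size (take k s) by rewrite size_takel // ltnW.
have : 0 < size (drop k s) by rewrite size_drop subn_gt0.
case D2: (drop k s) => [//|v s2] _; case/lastP D1: (take k s) => [//|s1 u] _.
exists u, s1, s2, v; split.
- by rewrite -cat_rcons -D1 -D2 cat_take_drop.
- by rewrite E1 D1; apply/suffixP; exists l.
- by rewrite E2 D2; apply/prefixP; exists r.
Qed.

Lemma infix_catl s q1 q2 : infix s q1 -> infix s (q1 ++ q2).
Proof. by case/infixP=> l [r ->]; apply/infixP; exists l, (r ++ q2); rewrite !catA. Qed.

Lemma infix_catr s q1 q2 : infix s q2 -> infix s (q1 ++ q2).
Proof. by case/infixP=> l [r ->]; apply/infixP; exists (q1 ++ l), r; rewrite !catA. Qed.

(** Both directions count, since a rotation reverses an initial stretch of the path and leaves the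
    blocks inside it intact. *)
Definition unbroken s q := infix s q || infix (rev s) q.

Lemma unbroken_rev s q : unbroken s (rev q) = unbroken s q.
Proof. by rewrite /unbroken orbC infix_rev -(infix_rev s (rev q)) revK. Qed.

Lemma unbroken_revl s q : unbroken (rev s) q = unbroken s q.
Proof. by rewrite /unbroken orbC revK. Qed.

Lemma unbroken_mem s q : unbroken s q -> {subset s <= q}.
Proof.
case/orP=> /mem_infix h x xs; apply: h => //.
by rewrite mem_rev.
Qed.

Lemma unbroken_cat s q1 q2 : unbroken s (q1 ++ q2) ->
  [\/ unbroken s q1, unbroken s q2
    | exists u v s1 s2 q1' q2', [/\ q1 = rcons q1' u, q2 = v :: q2' &
        s = s1 ++ u :: v :: s2 \/ s = s1 ++ v :: u :: s2]].
Proof.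
have main t : infix t (q1 ++ q2) -> [\/ infix t q1, infix t q2
    | exists u v s1 s2 q1' q2', [/\ q1 = rcons q1' u, q2 = v :: q2' &
        t = s1 ++ u :: v :: s2]].
  case/infix_cat_split; [by constructor 1|by constructor 2|].
  move=> [u [s1 [s2 [v [-> /suffixP[w ->] /prefixP[w' ->]]]]]]; constructor 3.
  by exists u, v, s1, s2, (w ++ s1), (s2 ++ w'); rewrite rcons_cat.
case/orP=> /main[h|h|[u [v [s1 [s2 [q1' [q2' [E1 E2 E]]]]]]]].
- by constructor 1; rewrite /unbroken h.
- by constructor 2; rewrite /unbroken h.
- by constructor 3; exists u, v, s1, s2, q1', q2'; split => //; left.
- by constructor 1; rewrite /unbroken h orbT.
- by constructor 2; rewrite /unbroken h orbT.
constructor 3; exists u, v, (rev s2), (rev s1), q1', q2'; split => //; right.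
by rewrite -[s]revK E rev_cat !rev_cons -!cats1 -!catA.
Qed.

Lemma unbroken_catl s q1 q2 : unbroken s q1 -> unbroken s (q1 ++ q2).
Proof. by case/orP=> /infix_catl h; rewrite /unbroken h ?orbT. Qed.

Lemma unbroken_catr s q1 q2 : unbroken s q2 -> unbroken s (q1 ++ q2).
Proof. by case/orP=> /infix_catr h; rewrite /unbroken h ?orbT. Qed.

Definition nxt q u := nth u q (index u q).+1.

Lemma infix_nxt q u v : uniq q -> infix [:: u; v] q -> v = nxt q u.
Proof.
move=> uq /infixP[a [b E]]; move: uq; rewrite E /nxt cat_uniq => /and3P[_ ua _].
have nua : u \notin a by apply: contra ua => ua; apply/hasP; exists u; rewrite ?mem_head.
by rewrite /= index_cat (negbTE nua) /= eqxx addn0 nth_cat ltnNge leqnSn /= subSnn.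
Qed.

Lemma infix_prv q u v : uniq q -> infix [:: v; u] q -> v = nxt (rev q) u.
Proof. by move=> uq h; apply: infix_nxt; rewrite ?rev_uniq // -[[:: _; _]]revK infix_rev. Qed.

End Infixes.

(** * Rotations of paths *)

Section Rotations.
Variable V : finType.
Implicit Types (q s : seq V) (X Y : {set V}).

(** Neighbours along the path [q], as opposed to the graph neighbours [nbs]. *)
Definition neighbours q X := [set p | [exists y in X, unbroken [:: y; p] q]].

Lemma card_neighbours q X : uniq q -> #|neighbours q X| <= 2 * #|X|.
Proof.
move=> uq; have sub : neighbours q X \subset nxt q @: X :|: nxt (rev q) @: X.
  apply/subsetP=> p; rewrite !inE => /exists_inP[y yX /orP[h|h]]; apply/orP.
    by left; rewrite (infix_nxt uq h) imset_f.
  by right; rewrite (infix_prv uq h) imset_f.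
apply: leq_trans (subset_leq_card sub) _.
apply: leq_trans (leq_card_setU _ _) _.
by rewrite mul2n -addnn leq_add ?leq_imset_card.
Qed.

Lemma neighboursS q X Y : X \subset Y -> neighbours q X \subset neighbours q Y.
Proof.
move=> /subsetP sXY; apply/subsetP=> p; rewrite !inE => /exists_inP[y /sXY yY h].
by apply/exists_inP; exists y.
Qed.

Variable e : rel V.
Hypothesis e_sym : symmetric e.

Definition is_path q := sorted e q && uniq q.

Lemma sorted_catE q y t :
  sorted e (q ++ y :: t) = [&& sorted e q, (q == [::]) || e (last y q) y & path e y t].
Proof. by case: q => //= x q; rewrite cat_path. Qed.

Lemma sorted_rev q : sorted e (rev q) = sorted e q.
Proof. by rewrite rev_sorted; apply: eq_sorted => x y; rewrite e_sym. Qed.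

Lemma is_path_rev q : is_path (rev q) = is_path q.
Proof. by rewrite /is_path sorted_rev rev_uniq. Qed.

Lemma is_path_catl q1 q2 : is_path (q1 ++ q2) -> is_path q1.
Proof.
rewrite /is_path cat_uniq => /andP[+ /and3P[-> _ _]].
by case: q2 => [|y t]; rewrite ?cats0 ?sorted_catE; [move=> ->|case/and3P=> ->].
Qed.

Lemma is_path_catr q1 q2 : is_path (q1 ++ q2) -> is_path q2.
Proof. by rewrite -is_path_rev rev_cat => /is_path_catl; rewrite is_path_rev. Qed.

(** Posa rotation: the edge [x p] replaces the path edge entering [p], whose other end becomes the
    new head; the last vertex stays. *)
Definition rotation q q' := exists x a p b,
  [/\ q = (x :: a) ++ p :: b, e x p & q' = rev (x :: a) ++ p :: b].

(** Idle steps are allowed, so this means at most [i] rotations and [heads i q] grows with [i]. *)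
Fixpoint rotations i q q' := if i is i'.+1 then
    exists2 q1, rotations i' q q1 & q' = q1 \/ rotation q1 q'
  else q' = q.

Lemma rotation_path q q' : rotation q q' -> is_path q ->
  [/\ is_path q', perm_eq q' q & forall z, last z q' = last z q].
Proof.
move=> [x [a [p [b [-> exp ->]]]]]; rewrite /is_path => /andP[].
rewrite !sorted_catE sorted_rev => /and3P[sa la pb] u.
have pe : perm_eq (rev (x :: a) ++ p :: b) ((x :: a) ++ p :: b).
  by rewrite perm_cat2r perm_rev.
split => //; last by move=> z; rewrite !last_cat.
by rewrite (perm_uniq pe) u sa pb rev_cons last_rcons exp orbT.
Qed.

Lemma rotations_path i q q' : rotations i q q' -> is_path q ->
  [/\ is_path q', perm_eq q' q & forall z, last z q' = last z q].
Proof.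
elim: i q' => [|i IH] q' /=; first by move=> ->.
case=> q1 /IH h + pq; case: (h pq) => p1 e1 l1 [->|r] //.
case: (rotation_path r p1) => p2 e2 l2; split => //.
  exact: perm_trans e2 e1.
by move=> z; rewrite l2 l1.
Qed.

Lemma rotations_leq i j q q' : i <= j -> rotations i q q' -> rotations j q q'.
Proof.
move=> /subnK <-; elim: (j - i) => // k IH /IH h; rewrite addSn /=.
by exists q' => //; left.
Qed.

Definition heads i q : {set V} := [set x | `[< exists t, rotations i q (x :: t) >]].

Definition all_heads q : {set V} :=
  [set x | `[< exists i t, rotations i q (x :: t) >]].

Lemma headsP i q x : reflect (exists t, rotations i q (x :: t)) (x \in heads i q).
Proof. by rewrite inE; apply: asboolP. Qed.

Lemma all_headsP q x :
  reflect (exists i t, rotations i q (x :: t)) (x \in all_heads q).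
Proof. by rewrite inE; apply: asboolP. Qed.

Lemma heads_sub i j q : i <= j -> heads i q \subset heads j q.
Proof.
move=> le; apply/subsetP=> x /headsP[t h]; apply/headsP; exists t.
exact: rotations_leq h.
Qed.

Lemma heads_all i q : heads i q \subset all_heads q.
Proof. by apply/subsetP=> x /headsP[t h]; apply/all_headsP; exists i, t. Qed.

Lemma heads_mem i q : is_path q -> {subset heads i q <= q}.
Proof.
move=> pq x /headsP[t /rotations_path-/(_ pq)[_ pe _]].
by rewrite -(perm_mem pe) mem_head.
Qed.

Lemma all_heads_mem q : is_path q -> {subset all_heads q <= q}.
Proof.
move=> pq x /all_headsP[i [t /rotations_path-/(_ pq)[_ pe _]]].
by rewrite -(perm_mem pe) mem_head.
Qed.

Lemma mem_heads0 x t : x \in heads 0 (x :: t).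
Proof. by apply/headsP; exists t. Qed.

Lemma unbroken_rotation s x a p b : unbroken s ((x :: a) ++ p :: b) ->
  unbroken s (rev (x :: a) ++ p :: b) \/ exists s1 s2,
    s = s1 ++ last x a :: p :: s2 \/ s = s1 ++ p :: last x a :: s2.
Proof.
case/unbroken_cat=> [h|h|].
- by left; apply: unbroken_catl; rewrite unbroken_rev.
- by left; apply: unbroken_catr.
move=> [u [v [s1 [s2 [q1 [q2 [E1 [-> _] E]]]]]]]; right.
exists s1, s2; suff -> : last x a = u by [].
by rewrite -[last x a]/(last x (x :: a)) E1 last_rcons.
Qed.

Lemma rotations_unbroken2 i q q' u v : rotations i q q' ->
  unbroken [:: u; v] q ->
  [|| unbroken [:: u; v] q', u \in heads i q | v \in heads i q].
Proof.
elim: i q' => [|i IH] q' /=; first by move=> -> ->.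
case=> q1 r1 + u0; have {IH u0} := IH _ r1 u0.
have sub := subsetP (heads_sub q (leqnSn i)).
case/or3P=> [u1|/sub->|/sub->]; rewrite ?orbT //.
move=> [->|]; first by rewrite u1.
move=> [x [a [p [b [E exp E']]]]].
have lh : last x a \in heads i.+1 q.
  apply/headsP; case: (lastP a) E E' => [|a' z] E E'.
    by exists (p :: b); exists q1; [|left].
  exists (rev (x :: a') ++ p :: b); exists q1 => //; right.
  exists x, (rcons a' z), p, b; split => //.
  by rewrite last_rcons -rcons_cons rev_rcons.
move: u1; rewrite E => /unbroken_rotation[|[s1 [s2 E2]]]; first by rewrite E' => ->.
by case: E2; case: s1 => [|? [|? []]] //= [-> ->]; rewrite lh ?orbT.
Qed.

(* An edge of q is lost only in a rotation turning one of its ends into the head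
   of the path; so if p is neither a head nor next to one, both its edges of q
   are still present, and rotating at p makes a neighbour of p a head. *)
Lemma posa i q x p : is_path q -> x \in heads i q -> p \in q -> e x p ->
  p \in heads i q :|: neighbours q (heads i.+1 q).
Proof.
move=> pq /headsP[t r] pinq exp; rewrite inE; apply/orP.
have [|pnh] := boolP (p \in heads i q); [by left|right].
case: (rotations_path r pq) => p' pe l'.
case/andP: (pq) => _ uq; case/andP: (p') => _ uq'.
have px : p != x by apply: contraNneq pnh => ->; apply/headsP; exists t.
move: (pinq); rewrite -(perm_mem pe) inE (negbTE px) /= => pt.
case/splitPr: pt r pe l' p' uq' => a b r pe l' p' uq'.
have yh : last x a \in heads i.+1 q.
  apply/headsP; case/lastP: a r {pe l' p' uq'} => [|a z] r.
    by exists (p :: b); apply: rotations_leq r.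
  exists (rev (x :: a) ++ p :: b); exists (x :: rcons a z ++ p :: b) => //; right.
  exists x, (rcons a z), p, b; split => //.
  by rewrite last_rcons -rcons_cons rev_rcons.
set q' := x :: a ++ p :: b in r pe l' p' uq'.
have yp : infix [:: last x a; p] q'.
  apply/infixP; exists (belast x a), b.
  by rewrite /q' -cat_cons lastI cat_rcons.
(* An edge of [q] at [p] can be lost only if [w] has become a head, since [p] is none. *)
have key w : unbroken [:: w; p] q ->
    p \in neighbours q (heads i.+1 q) \/ unbroken [:: w; p] q'.
  move=> h; case/or3P: (rotations_unbroken2 r h) => [|wh|]; first by right.
    left; rewrite inE; apply/exists_inP; exists w => //.
    exact: (subsetP (heads_sub q (leqnSn i))).
  by rewrite (negbTE pnh).
(* If [w] still precedes [p] on the current path, it is [last x a], which one more rotation makes a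
   head. *)
have fin w : unbroken [:: w; p] q -> infix [:: w; p] q' ->
    p \in neighbours q (heads i.+1 q).
  move=> h /(infix_prv uq') E; have := infix_prv uq' yp.
  rewrite -E => {}E; rewrite inE; apply/exists_inP.
  by exists (last x a) => //; rewrite E.
case/splitPr: pinq @q' r pe l' p' uq' uq pq yp key fin pnh yh => c d q' r pe l' p' uq' uq pq yp key fin pnh yh.
case/lastP: c => [|c u] in r pe l' uq pq yp key fin pnh yh *.
  by case/negP: pnh; apply: (subsetP (heads_sub _ (leq0n i))); apply: mem_heads0.
have up : unbroken [:: u; p] (rcons c u ++ p :: d).
  by apply/orP; left; apply/infixP; exists c, d; rewrite cat_rcons.
case: (key _ up) => // /orP[/fin->//|pu].
have Eu := infix_nxt uq' pu.
case: d => [|w d] in r pe l' uq pq yp key fin pnh yh up *.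
  have Ep : last p q' = p by rewrite (l' p) last_cat.
  case/infixP: pu uq' => l [rr E']; move: Ep; rewrite E' last_cat /= => Ep.
  rewrite cat_uniq /= => /and3P[_ _ /andP[+ _]].
  by rewrite -{1}Ep mem_last.
have wp : unbroken [:: w; p] (rcons c u ++ p :: w :: d).
  by apply/orP; right; apply/infixP; exists (rcons c u), d.
case: (key _ wp) => // /orP[/fin->//|pw].
have Ew := infix_nxt uq' pw.
(* Otherwise both neighbours [u] and [w] of [p] on [q] would be its only successor on [q']. *)
move: uq; rewrite cat_uniq => /and3P[_ /hasPn/(_ w)].
by rewrite (etrans Ew (esym Eu)) mem_rcons !inE eqxx !orbT => /(_ isT).
Qed.

Lemma posa_all q x p : is_path q -> x \in all_heads q -> p \in q -> e x p ->
  p \in all_heads q :|: neighbours q (all_heads q).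
Proof.
move=> pq /all_headsP[i [t r]] pinq exp.
have xh : x \in heads i q by apply/headsP; exists t.
case/setUP: (posa pq xh pinq exp) => h; apply/setUP.
  by left; apply: (subsetP (heads_all i q)).
by right; apply: (subsetP (neighboursS q (heads_all i.+1 q))).
Qed.

(** A rotation deletes only the path edge entering [p], and [p] lies on at most one of the disjoint
    segments. *)
Lemma rotations_broken (T : finType) (I : T -> seq V) i q q' :
    (forall j k x, x \in I j -> x \in I k -> j = k) -> rotations i q q' ->
  #|[set j | ~~ unbroken (I j) q']| <= i + #|[set j | ~~ unbroken (I j) q]|.
Proof.
move=> dI; elim: i q' => [|i IH] q' /=; first by move=> ->.
case=> q1 /IH h [->|r]; first by rewrite addSn ltnW.
rewrite addSn; apply: leq_trans (_ : #|[set j | ~~ unbroken (I j) q1]|.+1 <= _) => //.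
case: r => x [a [p [b [E1 exp E2]]]].
set B := [set j | p \in I j].
have B1 : #|B| <= 1.
  apply/card_le1_eqP => j k; by rewrite !inE => hj hk; apply: dI hk hj.
apply: leq_trans (leq_trans (leq_card_setU B _) (leq_add B1 (leqnn _))).
apply: subset_leq_card; apply/subsetP=> j; rewrite !inE => nu.
have [//|pI /=] := boolP (p \in I j); apply: contra nu => u1.
move: u1; rewrite E1 => /unbroken_rotation[|[s1 [s2 F]]]; first by rewrite E2.
by case/negP: pI; case: F => ->; rewrite mem_cat !inE eqxx ?orbT.
Qed.

End Rotations.

(** * Hamilton cycles and paths *)

Section Hamilton.
Variables (V : finType) (e : rel V).
Hypothesis e_sym : symmetric e.
Implicit Types (q s I J : seq V) (X Y A U : {set V}) (m r : nat).

Definition joined m := forall X Y, [disjoint X & Y] -> m <= #|X| -> m <= #|Y| ->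
  exists x y, [/\ x \in X, y \in Y & e x y].

Definition nbs X := [set y | [exists x in X, e x y]].

(** [X] need not lie in [A], so this also gives expansion between disjoint sets. The factor 4 makes
    head sets double in [heads_double]. *)
Definition expands A m := forall X, X != set0 -> #|X| <= m ->
  4 * #|X| <= #|(nbs X :&: A) :\: X|.

Lemma card_seq_set q : uniq q -> #|[set x in q]| = size q.
Proof. by move=> uq; rewrite cardsE; apply/card_uniqP. Qed.

(** Both path edges at an interior vertex of a block belong to the block; this lets Posa's lemma be
    read inside one segment. *)
Lemma unbroken_interior q I y p : uniq q -> unbroken I q ->
  unbroken [:: y; p] q -> p \in I -> p != head p I -> p != last p I ->
  unbroken [:: y; p] I.
Proof.
move=> uq; wlog infI : I / infix I q => [hw|_].
  case/orP=> [h|h]; first by apply: hw; rewrite // /unbroken h.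
  move=> h1 h2 h3 h4; rewrite -[I]revK unbroken_rev.
  apply: hw => //; first by rewrite /unbroken h.
  - by rewrite mem_rev.
  - by case/lastP: I {h h1 h2 h3} h4 => // I z; rewrite rev_rcons last_rcons.
  - by case: I {h h1 h2 h4} h3 => // z I; rewrite rev_cons last_rcons.
case/infixP: infI => l [r E] + pI; case/splitPr: pI E => c d E.
case/orP=> h nh nl.
  case/lastP: c => [|c u] in E nh nl *; first by rewrite eqxx in nh.
  have h' : infix [:: u; p] q.
    by apply/infixP; exists (l ++ c), (d ++ r); rewrite E cat_rcons -!catA.
  rewrite (infix_prv uq h) -(infix_prv uq h'); apply/orP; left.
  by apply/infixP; exists c, d; rewrite cat_rcons.
case: d => [|u d] in E nh nl *; first by rewrite last_cat /= eqxx in nl.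
have h' : infix [:: p; u] q.
  by apply/infixP; exists (l ++ c), (d ++ r); rewrite E -!catA.
rewrite (infix_nxt uq h) -(infix_nxt uq h'); apply/orP; right.
by apply/infixP; exists c, d.
Qed.

(** A vertex outside this set, as head of any path keeping [I] unbroken, has at least [m] endpoints
    reachable by rotations. *)
Definition bad m I := [set v | `[< exists t,
  [/\ is_path e (v :: t), unbroken I (v :: t) & #|all_heads e (v :: t)| < m] >]].

(* Few vertices are bad for a long segment: otherwise a union U of head sets of
   fewer than m vertices would have between m and 2m vertices, while by Posa's
   lemma its neighbours inside I lie in U or next to U. *)
Lemma card_bad m I : joined m -> 0 < m -> uniq I -> 7 * m + 2 <= size I ->
  #|bad m I| < m.
Proof.
move=> jm m0 uI sI; rewrite ltnNge; apply/negP=> mb.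
have /boolp.choice[S hS] : forall v, exists S : {set V}, v \in bad m I ->
    [/\ v \in S, #|S| < m & forall x p, x \in S -> p \in I ->
        p != head p I -> p != last p I -> e x p ->
        p \in S :|: neighbours I S].
  move=> v; case: (boolP (v \in bad m I)) => [|_]; last by exists set0.
  rewrite inE => /asboolP[t [pv uv cv]]; exists (all_heads e (v :: t)) => _; split=> //.
    exact: (subsetP (heads_all e 0 _)) (mem_heads0 _ _ _).
  move=> x p xS pI ph pl exp.
  case/setUP: (posa_all e_sym pv xS (unbroken_mem uv pI) exp) => h; apply/setUP; [by left|right].
  move: h; rewrite !inE => /exists_inP[y yS h]; apply/exists_inP; exists y => //.
  by apply: unbroken_interior uv h pI ph pl; case/andP: pv.
pose cov (B : {set V}) := \bigcup_(v in B) S v.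
have mcov : m <= #|cov (bad m I)|.
  apply: leq_trans mb (subset_leq_card _); apply/subsetP=> v vb.
  by apply/bigcupP; exists v => //; case: (hS v vb).
pose P (B : {set V}) := (B \subset bad m I) && (m <= #|cov B|).
have Pb : P (bad m I) by rewrite /P subxx.
(* In a minimal family covering at least [m] vertices, dropping one member leaves fewer than [m], so
   the union has at most [2 * m]. *)
case: (@arg_minnP _ (bad m I) P (fun B : {set V} => #|B|) Pb) => B /andP[sB mB] minB.
set U := cov B in mB.
have U2 : #|U| <= 2 * m.
  case: (set_0Vmem B) => [B0|[v vB]].
    by move: mB; rewrite /U B0 /cov big_set0 cards0 leqNgt m0.
  rewrite /U /cov (big_setD1 v) //=.
  apply: leq_trans (leq_card_setU _ _) _.
  have [_ Sv _] := hS _ (subsetP sB _ vB).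
  rewrite mul2n -addnn leq_add ?(ltnW Sv) // leqNgt; apply/negP=> h.
  have := minB (B :\ v); rewrite /P (subset_trans (subD1set _ _) sB) (ltnW h) => /(_ isT).
  by rewrite (cardsD1 v B) vB ltnn.
pose D := [set p in I | (p != head p I) && (p != last p I)].
have cD : size I <= #|D| + 2.
  case: I sI uI {mb hS mcov Pb minB sB P mB} @D => [|i0 J] // sI uI D.
  rewrite -(card_seq_set uI).
  have -> : [set x in i0 :: J] = D :|: [set i0; last i0 J].
    apply/setP=> x; rewrite !inE /=.
    case: (eqVneq x i0) => [->|]; rewrite ?eqxx ?orbT //= => nx.
    case: (eqVneq x (last i0 J)) => [E|]; rewrite ?orbT ?orbF ?andbT //.
    by have := mem_last i0 J; rewrite -E inE (negbTE nx).
  apply: leq_trans (leq_card_setU _ _) _; rewrite leq_add2l cards2.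
  by case: (_ != _).
(* At least [7 * m] interior vertices, less at most [2 * m] in [U] and [4 * m] next to it. *)
have cY : m <= #|D :\: (U :|: neighbours I U)|.
  have := (leq_card_setU U (neighbours I U)).1; have := card_neighbours U uI.
  have := subset_leq_card (subsetIr D (U :|: neighbours I U)).
  have := cardsID (U :|: neighbours I U) D.
  by lia.
have dUY : [disjoint U & D :\: (U :|: neighbours I U)].
  rewrite -setI_eq0; apply/eqP/setP=> x; rewrite !inE.
  by case: (x \in U); rewrite ?andbF.
have [x [p [xU]]] := jm _ _ dUY mB cY.
rewrite in_setD => /andP[/negP nU]; rewrite inE => /and3P[pI ph pl] exp; apply: nU.
case/bigcupP: xU => v vB xS; have [_ _ /(_ x p xS pI ph pl exp)] := hS _ (subsetP sB _ vB).
have sv : S v \subset U by apply: bigcup_sup.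
case/setUP=> h; apply/setUP; [left; exact: (subsetP sv)|right].
exact: (subsetP (neighboursS I sv)).
Qed.

Definition longest A q := [/\ is_path e q, {subset q <= A} &
  forall q', is_path e q' -> {subset q' <= A} -> size q' <= size q].

Lemma longest_exists A a : a \in A -> exists2 q, longest A q & 0 < size q.
Proof.
move=> aA; pose P n := `[< exists q, [/\ is_path e q, {subset q <= A} & size q = n] >].
have P1 : exists n, P n.
  by exists 1; apply/asboolP; exists [:: a]; split=> // x; rewrite inE => /eqP->.
have Pb n : P n -> n <= #|A|.
  case/asboolP=> q [/andP[_ /card_seq_set uq] sq <-]; rewrite -uq.
  by apply/subset_leq_card/subsetP=> x; rewrite inE; apply: sq.
case: (ex_maxnP P1 Pb) => n /asboolP[q [pq sq zq]] mx; exists q.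
  split=> // q' pq' sq'; rewrite zq; apply: mx; apply/asboolP; by exists q'.
rewrite zq; apply: mx; apply/asboolP.
by exists [:: a]; split=> // x; rewrite inE => /eqP->.
Qed.

Lemma longest_perm A q q' : longest A q -> is_path e q' -> perm_eq q' q -> longest A q'.
Proof.
move=> [_ sq mq] pq' pe; split=> // [x|s]; first by rewrite (perm_mem pe); apply: sq.
by rewrite (perm_size pe); apply: mq.
Qed.

Lemma longest_rotations A q i q' : longest A q -> rotations e i q q' -> longest A q'.
Proof.
move=> lq r; have [pq _ _] := lq; have [pq' pe _] := rotations_path e_sym r pq.
exact: longest_perm lq pq' pe.
Qed.

Lemma longest_head A x t y : longest A (x :: t) -> y \in A -> e x y -> y \in x :: t.
Proof.
move=> [/andP[/= st ut] sq mq] yA exy; apply/negPn/negP=> ny.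
have py : is_path e (y :: x :: t).
  by apply/andP; split; [rewrite /= e_sym exy | rewrite cons_uniq ny].
have /(mq _ py) : {subset y :: x :: t <= A}.
  by move=> z; rewrite inE => /orP[/eqP->//|]; apply: sq.
by rewrite /= ltnn.
Qed.

(** * Growth of the head sets of a longest path *)

Section Growth.
Variables (A : {set V}) (m : nat) (q : seq V).
Hypothesis lq : longest A q.

Lemma longest_nbs i : nbs (heads e i q) :&: A \subset
  heads e i q :|: neighbours q (heads e i.+1 q).
Proof.
have [pq _ _] := lq.
apply/subsetP=> y; rewrite in_setI inE => /andP[/exists_inP[x xh exy] yA].
apply: (posa e_sym pq xh _ exy).
case/headsP: (xh) => t r; have := longest_head (longest_rotations lq r) yA exy.
by have [_ pe _] := rotations_path e_sym r pq; rewrite (perm_mem pe).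
Qed.

(** The outside neighbours, at least four per head, are all path neighbours of the next heads, which
    have at most two each. *)
Lemma heads_double i : expands A m -> heads e i q != set0 -> #|heads e i q| <= m ->
  2 * #|heads e i q| <= #|heads e i.+1 q|.
Proof.
have [pq _ _] := lq; have /andP[_ uq] := pq.
move=> ex h0 hm; have := ex _ h0 hm.
have sub : nbs (heads e i q) :&: A :\: heads e i q \subset neighbours q (heads e i.+1 q).
  apply/subsetP=> y; rewrite in_setD => /andP[/negbTE ny /(subsetP (longest_nbs i))].
  by rewrite in_setU ny.
have := subset_leq_card sub; have := card_neighbours (heads e i.+1 q) uq; lia.
Qed.

Lemma card_heads i : expands A m -> 0 < size q -> minn (2 ^ i) m <= #|heads e i q|.
Proof.
move=> ex sq; elim: i => [|i IH].
  rewrite expn0; apply: leq_trans (geq_minl _ _) _; rewrite card_gt0.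
  by case: q sq => // x t _; apply/set0Pn; exists x; apply: mem_heads0.
have [le|lt] := leqP m #|heads e i q|.
  apply: leq_trans (geq_minr _ _) (leq_trans le _).
  exact/subset_leq_card/heads_sub.
have [h0|h0] := eqVneq (heads e i q) set0.
  move: IH; rewrite h0 cards0 leqn0; have := expn_gt0 2 i; lia.
have := heads_double ex h0 (ltnW lt); rewrite expnS; lia.
Qed.

(** After [r] steps there are [m] heads. They send no edge to the vertices of [A] outside [N], which
    are thus fewer than [m]; and [N] is at most three times the next head set. *)
Lemma card_heads_big r : expands A m -> joined m -> 0 < size q -> m <= 2 ^ r ->
  #|A| <= m + 3 * #|heads e r.+1 q|.
Proof.
have [pq sq _] := lq; have /andP[_ uq] := pq.
move=> ex jm q0 mr; have := card_heads r ex q0; rewrite (minn_idPr mr) => hm.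
rewrite leqNgt; apply/negP=> lt.
have sub := subset_leq_card (heads_sub e q (leqnSn r)).
set N := heads e r q :|: neighbours q (heads e r.+1 q).
have cY : m <= #|A :\: N|.
  have := (leq_card_setU (heads e r q) (neighbours q (heads e r.+1 q))).1.
  have := card_neighbours (heads e r.+1 q) uq.
  have := subset_leq_card (subsetIr A N); have := cardsID N A; rewrite -/N; lia.
have dj : [disjoint heads e r q & A :\: N].
  rewrite -setI_eq0; apply/eqP/setP=> x; rewrite in_set0 in_setI in_setD in_setU.
  by case: (x \in heads _ _ _).
have [x [y [xh /setDP[yA /negP yN] exy]]] := jm _ _ dj hm cY.
apply: yN; apply: (subsetP (longest_nbs r)); rewrite in_setI yA andbT inE.
by apply/exists_inP; exists x.
Qed.

End Growth.

(** * Segments of a path and the closing of paths to cycles *)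

Lemma split_unbroken q I J : unbroken I q -> unbroken J q -> I != [::] -> J != [::] ->
    (forall x, x \in I -> x \in J -> False) ->
  exists q1 q2, q = q1 ++ q2 /\
   (unbroken I q1 /\ unbroken J q2 \/ unbroken J q1 /\ unbroken I q2).
Proof.
move=> uI uJ I0 J0 dIJ.
have [I' [l [r [E uI' mI']]]] : exists I' l (w : seq V),
    [/\ q = l ++ I' ++ w, unbroken I I' & I' =i I].
  case/orP: uI => /infixP[l [r E]]; [exists I|exists (rev I)]; exists l, r; split=> //.
  - by rewrite /unbroken infix_refl.
  - by rewrite /unbroken infix_refl orbT.
  - by move=> x; rewrite mem_rev.
have I'0 : I' != [::].
  case: I I0 mI' {uI uI' dIJ} => // i I _ /(_ i); rewrite mem_head.
  by case: I' E.
move: uJ; rewrite E => /unbroken_cat[h|/unbroken_cat[h|h|]|].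
- exists l, (I' ++ r); split=> //; right; split=> //; exact: unbroken_catl.
- case: J J0 h dIJ {uI} => // j J _ /unbroken_mem/(_ j (mem_head _ _)).
  by rewrite mI' => jI /(_ j jI); rewrite mem_head => /(_ isT).
- exists (l ++ I'), r; rewrite catA; split=> //; left; split=> //; exact: unbroken_catr.
- move=> [u [v [s1 [s2 [q1 [q2 [E1 _ EJ]]]]]]]; exfalso; apply: (dIJ u).
    by rewrite -mI' E1 mem_rcons mem_head.
  by case: EJ => ->; rewrite mem_cat !inE eqxx ?orbT.
- move=> [u [v [s1 [s2 [q1 [q2 [_ E2 EJ]]]]]]]; exfalso; apply: (dIJ v).
    by rewrite -mI'; case: I' I'0 E2 {E uI' mI'} => // i I' _ /= [-> _]; rewrite mem_head.
  by case: EJ => ->; rewrite mem_cat !inE eqxx ?orbT.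
Qed.

Lemma mem_segment q x l j : uniq q -> x \in take l (drop (j * l) q) -> index x q %/ l = j.
Proof.
move=> uq xI; have l0 : 0 < l by case: l xI; rewrite ?take0.
have xd := mem_take xI.
have := index_mem x (take l (drop (j * l) q)); rewrite xI => lt1.
have Ei : index x (take l (drop (j * l) q)) = index x (drop (j * l) q).
  by rewrite -{2}(cat_take_drop l (drop (j * l) q)) index_cat xI.
have Eq : index x q = j * l + index x (drop (j * l) q).
  have jq : j * l < size q.
    by move: xd; apply: contraTltn => /drop_oversize ->.
  rewrite -{1}(cat_take_drop (j * l) q) index_cat size_takel ?(ltnW jq) //.
  case: ifP => // xt; move: uq; rewrite -{1}(cat_take_drop (j * l) q) cat_uniq.
  by case/and3P=> _ /hasPn/(_ x xd); rewrite /= xt.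
have lt : index x (drop (j * l) q) < l.
  by rewrite -Ei; apply: leq_trans lt1 _; rewrite size_take; case: ltnP.
by rewrite Eq divnMDl // divn_small // addn0.
Qed.

Lemma cycle_join x t1 y t2 : is_path e (x :: t1) -> is_path e (y :: t2) ->
  e x y -> e (last x t1) (last y t2) -> cycle e (rev (x :: t1) ++ y :: t2).
Proof.
rewrite -(is_path_rev e_sym (x :: t1)) => /andP[s1 _] /andP[/= s2 _] exy ell.
have : sorted e (rev (x :: t1) ++ y :: t2).
  by rewrite sorted_catE s1 s2 rev_cons last_rcons exy orbT.
case/lastP: t1 {s1} ell => [|t1 z].
  by rewrite /= rcons_path [e _ x]e_sym => -> /andP[-> ->].
rewrite last_rcons -rcons_cons rev_rcons /= => ell h.
by rewrite rcons_path h last_cat /= e_sym.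
Qed.

(** * Hamilton cycles and paths inside an expanding set *)

Section Main.
Variables (A : {set V}) (m r : nat).
Hypotheses (m0 : 0 < m) (mr : m <= 2 ^ r) (jm : joined m) (exA : expands A m)
  (sA : 200 * ((r + 2) * m) <= #|A|).

Lemma longest_cycle q : longest A q -> 0 < size q ->
  exists c, [/\ perm_eq c q & cycle e c].
Proof.
(* [l] is the length required by [card_bad]. Each end undergoes at most [r.+1] rotations, so [R]
   exceeds by two the number of segments that can break. *)
move=> lq q0; pose l := 7 * m + 2; pose R := 2 * r + 4.
have [pq sq _] := lq; have /andP[_ uq] := pq.
have big p : longest A p -> 0 < size p -> R * (9 * m) < #|heads e r.+1 p|.
  move=> lp p0; have := card_heads_big lp exA jm p0 mr; rewrite /R.
  move: (#|heads e r.+1 p|) => k; move: sA m0; nia.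
have sql : R * l <= size q.
  apply: leq_trans (_ : #|heads e r.+1 q| <= _); last first.
    rewrite -(card_seq_set uq); apply/subset_leq_card/subsetP=> x /heads_mem h.
    by rewrite inE; apply: h.
  by apply: leq_trans (ltnW (big _ lq q0)); rewrite leq_mul2l /l; lia.
pose I (j : 'I_R) := take l (drop (j * l) q).
have sI j : size (I j) = l.
  have jR := ltn_ord j.
  rewrite /I size_takel // size_drop leq_subRL.
    by rewrite -mulSnr; apply: leq_trans sql; rewrite leq_mul2r jR orbT.
  by apply: leq_trans sql; rewrite leq_mul2r ltnW ?orbT.
have uI j : uniq (I j) by rewrite take_uniq ?drop_uniq.
have I0 j : I j != [::] by rewrite -size_eq0 sI /l addn2.
have dI j k x : x \in I j -> x \in I k -> j = k.
  move=> /(mem_segment uq) E /(mem_segment uq); rewrite E => h; exact: val_inj.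
have iI j : unbroken (I j) q.
  apply/orP; left; apply/infixP.
  exists (take (j * l) q), (drop l (drop (j * l) q)).
  by rewrite !cat_take_drop.
pose B := \bigcup_j bad m (I j).
have cB : #|B| <= R * (9 * m).
  rewrite /B; apply: leq_trans (_ : \sum_(j < R) m <= _); last first.
    by rewrite sum_nat_const card_ord leq_mul2l; apply/orP; right; lia.
  apply: (big_ind2 (fun (X : {set V}) n => #|X| <= n)); first by rewrite cards0.
    move=> X x Y y h1 h2; apply: leq_trans (leq_card_setU _ _) _; exact: leq_add.
  by move=> j _; apply: ltnW; apply: card_bad; rewrite ?sI.
have pick p : longest A p -> 0 < size p ->
    exists x t, [/\ rotations e r.+1 p (x :: t) & x \notin B].
  move=> lp p0; have : heads e r.+1 p :\: B != set0.
    rewrite -card_gt0; have := big _ lp p0; have := cardsID B (heads e r.+1 p).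
    have := subset_leq_card (subsetIr (heads e r.+1 p) B); lia.
  case/set0Pn=> x /setDP[/headsP[t rt] xB]; by exists x, t.
(* One end is chosen outside [B]; then the path is reversed and the other end chosen likewise, with
   [s] kept last. *)
have [s [t [r1 sB]]] := pick q lq q0.
have l1 := longest_rotations lq r1.
have pe1 : perm_eq (rev (s :: t)) (s :: t) by rewrite perm_rev.
have l1' : longest A (rev (s :: t)).
  by apply: (longest_perm l1 _ pe1); rewrite is_path_rev //; case: l1.
have [s' [t' [r2 s'B]]] : exists x u, [/\ rotations e r.+1 (rev (s :: t)) (x :: u)
     & x \notin B] by apply: pick => //; rewrite size_rev.
have [p2 _ _] := longest_rotations l1' r2.
have [p1' _ _] := l1'.
have [_ pe2 la2] := rotations_path e_sym r2 p1'.
have [_ pe3 _] := rotations_path e_sym r1 pq.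
have peq : perm_eq (s' :: t') q.
  exact: perm_trans pe2 (perm_trans pe1 pe3).
have las : last s' (s' :: t') = s by rewrite la2 rev_cons last_rcons.
have cbr : #|[set j | ~~ unbroken (I j) (s' :: t')]| <= r.+1 + r.+1.
  apply: leq_trans (rotations_broken dI r2) _; rewrite leq_add2l.
  have -> : [set j | ~~ unbroken (I j) (rev (s :: t))] =
            [set j | ~~ unbroken (I j) (s :: t)].
    by apply/setP=> j; rewrite !inE unbroken_rev.
  apply: leq_trans (rotations_broken dI r1) _.
  have -> : [set j | ~~ unbroken (I j) q] = set0.
    by apply/setP=> j; rewrite !inE iI.
  by rewrite cards0 addn0.
have : 1 < #|[set j | unbroken (I j) (s' :: t')]|.
  have := cardsC [set j | unbroken (I j) (s' :: t')].
  have -> : ~: [set j | unbroken (I j) (s' :: t')] =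
    [set j | ~~ unbroken (I j) (s' :: t')] by apply/setP=> j; rewrite !inE.
  rewrite card_ord; have : R = 2 * r + 4 by []; lia.
case/card_gt1P=> j [k []]; rewrite !inE => uj uk jk.
(* Cut between the two surviving segments: each piece, read from its outer end, has a head that is
   not bad. *)
have [j' [k' [q1 [q2 [Eq u1 u2]]]]] : exists j' k' q1 q2,
    [/\ s' :: t' = q1 ++ q2, unbroken (I j') q1 & unbroken (I k') q2].
  have dj x : x \in I j -> x \in I k -> False.
    by move=> xj xk; move: jk; rewrite (dI _ _ _ xj xk) eqxx.
  have [q1 [q2 [Eq [[h1 h2]|[h1 h2]]]]] := split_unbroken uj uk (I0 j) (I0 k) dj.
    by exists j, k, q1, q2.
  by exists k, j, q1, q2.
have nB x i p : x \notin B -> is_path e (x :: p) -> unbroken (I i) (x :: p) ->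
    m <= #|all_heads e (x :: p)|.
  move=> xB pp ui; rewrite leqNgt; apply: contra xB => lt.
  by apply/bigcupP; exists i => //; rewrite inE; apply/asboolP; exists p.
have q10 : q1 != [::].
  by apply: contraTneq u1 => ->; rewrite /unbroken !infixs0 -!size_eq0 size_rev size_eq0 (negbTE (I0 _)).
have q20 : q2 != [::].
  by apply: contraTneq u2 => ->; rewrite /unbroken !infixs0 -!size_eq0 size_rev size_eq0 (negbTE (I0 _)).
case: q1 q10 Eq u1 => [//|z q1] _ Eq u1; have [Ez Et] : z = s' /\ t' = q1 ++ q2 by case: Eq => -> ->.
subst z; clear Eq.
case/lastP: q2 q20 Et u2 => [//|q2 z] _ Et u2.
have {las}zs : z = s by rewrite -las Et /= last_cat last_rcons.
subst z; rewrite {}Et in peq p2 s'B r2 pe2 la2 cbr uj uk *.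
have upq : uniq ((s' :: q1) ++ rcons q2 s) by case/andP: p2.
have pq1 : is_path e (s' :: q1) by apply: (is_path_catl (q1 := s' :: q1) p2).
have pq2 : is_path e (s :: rev q2).
  by rewrite -rev_rcons is_path_rev //; apply: (is_path_catr e_sym (q1 := s' :: q1) p2).
have m1 := nB _ _ _ s'B pq1 u1.
have m2 : m <= #|all_heads e (s :: rev q2)|.
  by apply: nB sB pq2 _; rewrite -rev_rcons unbroken_rev; exact: u2.
have dH : [disjoint all_heads e (s' :: q1) & all_heads e (s :: rev q2)].
  rewrite -setI_eq0; apply/eqP/setP=> x; rewrite in_set0; apply/negbTE/negP.
  case/setIP=> /(all_heads_mem e_sym pq1) x1 /(all_heads_mem e_sym pq2).
  rewrite -rev_rcons mem_rev => x2; move: upq; rewrite cat_uniq => /and3P[_ /hasPn/(_ x x2)].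
  by rewrite /= x1.
have [x [y [/all_headsP[i1 [t1 rx]] /all_headsP[i2 [t2 ry]] exy]]] := jm dH m1 m2.
have [px pex lx] := rotations_path e_sym rx pq1.
have [py pey ly] := rotations_path e_sym ry pq2.
(* Rotations fix the last vertices of the two pieces, which are the vertices on either side of the
   cut and so adjacent. *)
have ell : e (last x t1) (last y t2).
  have := lx x; have := ly y; rewrite /= => -> ->.
  case/andP: p2 => + _; case: (q2) => [|d q3]; rewrite /= cat_path /= => /and3P[_ + _] //.
  by rewrite rev_cons last_rcons.
exists (rev (x :: t1) ++ y :: t2); split; last exact: cycle_join.
apply: perm_trans peq; rewrite -cat_cons; apply: perm_cat.
  by apply: perm_trans pex; rewrite perm_rev.
by apply: perm_trans pey _; rewrite -rev_rcons perm_rev.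
Qed.

(** A longest path closes to a cycle, so an edge from it to a missed vertex of [A] would give a
    longer path. Such an edge comes from expansion if at most [m] vertices are missed, from [joined]
    otherwise. *)
Lemma hamilton_cycle : exists c, [/\ uniq c, cycle e c & c =i A].
Proof.
have [a aA] : exists a, a \in A.
  by apply/set0Pn; rewrite -card_gt0; apply: leq_trans sA; rewrite !muln_gt0 m0 addn2.
have [q lq q0] := longest_exists aA.
have [pq sq mq] := lq; have /andP[_ uq] := pq.
have [c [pe cc]] := longest_cycle lq q0.
have uc : uniq c by rewrite (perm_uniq pe).
exists c; split=> // x; rewrite (perm_mem pe).
apply/idP/idP=> [/sq //|xA]; apply/negPn/negP=> nx.
suff [x' [y [x'A nx' yq exy]]] : exists x' y, [/\ x' \in A, x' \notin q, y \in q & e x' y].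
  have yc : y \in c by rewrite (perm_mem pe).
  have [i c' Ec] := rot_to yc.
  have : cycle e (y :: c') by rewrite -Ec rot_cycle.
  rewrite /= rcons_path => /andP[pc _].
  have pe' : perm_eq (y :: c') q by rewrite -Ec; apply: perm_trans pe; rewrite perm_rot.
  have px : is_path e (x' :: y :: c').
    apply/andP; split; first by rewrite /= exy.
    by rewrite cons_uniq (perm_mem pe') nx' (perm_uniq pe').
  have /(mq _ px) : {subset x' :: y :: c' <= A}.
    by move=> z; rewrite inE (perm_mem pe') => /orP[/eqP->//|]; apply: sq.
  by rewrite /= -/(size (y :: c')) (perm_size pe') ltnn.
pose X := A :\: [set z in q].
have X0 : X != set0 by apply/set0Pn; exists x; rewrite !inE nx.
have fin x' y : x' \in X -> y \in q -> e x' y ->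
    exists x' y, [/\ x' \in A, x' \notin q, y \in q & e x' y].
  by rewrite !inE => /andP[h1 h2] h3 h4; exists x', y.
have [le|lt] := leqP #|X| m.
  have : 0 < #|nbs X :&: A :\: X|.
    by apply: leq_trans (exA X0 le); rewrite muln_gt0 card_gt0 X0.
  rewrite card_gt0 => /set0Pn[y /setDP[/setIP[]]]; rewrite inE => /exists_inP[x' x'X exy] yA.
  by rewrite !inE yA andbT negbK => yq; apply: fin exy.
have mq' : m <= #|[set z in q]|.
  have h := card_heads_big lq exA jm q0 mr.
  have : heads e r.+1 q \subset [set z in q].
    by apply/subsetP=> z /heads_mem h'; rewrite inE; apply: h'.
  move/subset_leq_card; move: sA h m0; nia.
have dj : [disjoint X & [set z in q]].
  by rewrite -setI_eq0; apply/eqP/setP=> z; rewrite !inE; case: (z \in q); rewrite ?andbF.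
have [x' [y [x'X yq exy]]] := jm dj (ltnW lt) mq'.
by apply: fin exy; move: yq; rewrite inE.
Qed.

(** Open a Hamilton cycle at [a] and rotate the other end; [a] stays last. *)
Lemma hamilton_paths_from a : a \in A -> exists2 X : {set V}, m <= #|X| &
  forall x, x \in X -> exists t, [/\ is_path e (x :: t), x :: t =i A & last x t = a].
Proof.
move=> aA; have [c [uc cc ec]] := hamilton_cycle.
have ac : a \in c by rewrite ec.
have [i c' Ec] := rot_to ac.
have pa : is_path e (a :: c').
  rewrite /is_path -Ec rot_uniq uc andbT Ec.
  by move: cc; rewrite -(rot_cycle i) Ec /= rcons_path => /andP[].
have mem_a : a :: c' =i A by move=> x; rewrite -Ec mem_rot ec.
set q := rev (a :: c').
have pq : is_path e q by rewrite is_path_rev.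
have mem_q : q =i A by move=> x; rewrite mem_rev.
have uq : uniq q by case/andP: pq.
have szq : size q = #|A|.
  by rewrite -(card_seq_set uq); apply: eq_card => x; rewrite inE mem_q.
have lq : longest A q.
  split=> // [x|q' /andP[_ uq'] sq']; first by rewrite mem_q.
  rewrite szq -(card_seq_set uq').
  by apply/subset_leq_card/subsetP=> x; rewrite inE; apply: sq'.
have q0 : 0 < size q by rewrite size_rev.
exists (heads e r.+1 q).
  have h := card_heads_big lq exA jm q0 mr; move: sA h m0; nia.
move=> x /headsP[t rt]; have [px pe la] := rotations_path e_sym rt pq.
exists t; split=> // [z|]; first by rewrite (perm_mem pe) mem_q.
by rewrite -[last x t]/(last x (x :: t)) la /q rev_cons last_rcons.
Qed.

End Main.

Lemma hamilton_connected (A1 A2 : {set V}) m r a b :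
    0 < m -> m <= 2 ^ r -> joined m -> expands A1 m -> expands A2 m ->
    200 * ((r + 2) * m) <= #|A1| -> 200 * ((r + 2) * m) <= #|A2| ->
    [disjoint A1 & A2] -> a \in A1 -> b \in A2 ->
  exists t, [/\ is_path e (a :: t), a :: t =i A1 :|: A2 & last a t = b].
Proof.
move=> m0 mr jm ex1 ex2 s1 s2 d12 aA bA.
have [X1 m1 h1] := hamilton_paths_from m0 mr jm ex1 s1 aA.
have [X2 m2 h2] := hamilton_paths_from m0 mr jm ex2 s2 bA.
have sX1 : X1 \subset A1.
  by apply/subsetP=> x /h1[t [_ E _]]; rewrite -E mem_head.
have sX2 : X2 \subset A2.
  by apply/subsetP=> x /h2[t [_ E _]]; rewrite -E mem_head.
have dX : [disjoint X1 & X2].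
  by apply: disjointWl sX1 _; apply: disjointWr sX2 _.
have [x [y [/h1[t1 [p1 E1 l1]] /h2[t2 [p2 E2 l2]] exy]]] := jm _ _ dX m1 m2.
have : is_path e (rev (x :: t1) ++ y :: t2).
  move: (p1) (p2) => /andP[st1 u1] /andP[st2 u2]; apply/andP; split.
    rewrite sorted_catE sorted_rev // st1 rev_cons last_rcons exy orbT.
    exact: st2.
  rewrite cat_uniq rev_uniq u1 u2 andbT; apply/hasPn=> z; rewrite E2 => z2 /=.
  by rewrite mem_rev E1; move: d12 => /disjointFl/(_ z2)->.
have : rev (x :: t1) ++ y :: t2 =i A1 :|: A2.
  by move=> z; rewrite mem_cat mem_rev E1 E2 inE.
have : last a (rev (x :: t1) ++ y :: t2) = b by rewrite last_cat.
have [w ->] : exists w, rev (x :: t1) = a :: w.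
  rewrite -l1; case: (lastP t1) => [|t1' z]; first by exists [::].
  by exists (rev (x :: t1')); rewrite last_rcons -rcons_cons rev_rcons.
by exists (w ++ y :: t2).
Qed.

End Hamilton.

(** * Cuts *)

Section ColouredCycles.
Variables (V : finType) (M : comNzRingType).
Hypothesis M2 : forall x : M, (x + x = 0)%R.
Implicit Types (red : V -> V -> M) (phi : V -> M) (q t : seq V).

Fixpoint path_sum red x t : M :=
  if t is y :: t' then (red x y + path_sum red y t')%R else 0%R.

Definition cycle_sum red q : M :=
  if q is x :: t then path_sum red x (rcons t x) else 0%R.

Lemma path_sum_cat red x t y t' : path_sum red x (t ++ y :: t') =
  (path_sum red x t + red (last x t) y + path_sum red y t')%R.
Proof. by elim: t x => [|z t IH] x /=; rewrite ?add0r // IH !addrA. Qed.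

Lemma path_sum_rcons red x t y :
  path_sum red x (rcons t y) = (path_sum red x t + red (last x t) y)%R.
Proof. by rewrite -cats1 path_sum_cat /= addr0. Qed.

Lemma path_sum_rev red x t : (forall x y, red x y = red y x) ->
  path_sum red (last x t) (rev (belast x t)) = path_sum red x t.
Proof.
move=> rC; elim: t x => [|y t IH] x //=.
rewrite rev_cons path_sum_rcons IH addrC; congr (_ + _)%R.
suff -> : last (last y t) (rev (belast y t)) = y by [].
by case: t {IH} => [|z t] //=; rewrite rev_cons last_rcons.
Qed.

Lemma cycle_sum_join red x t1 y t2 : (forall x y, red x y = red y x) ->
  cycle_sum red (rev (x :: t1) ++ y :: t2) =
  (path_sum red x t1 + path_sum red y t2 + red x y + red (last x t1) (last y t2))%R.
Proof.
move=> rC; rewrite lastI rev_rcons /= rcons_cat rcons_cons path_sum_cat.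
rewrite path_sum_rev // path_sum_rcons [red (last y t2) _]rC.
suff -> : last (last x t1) (rev (belast x t1)) = x.
  by rewrite !addrA; congr (_ + _)%R; rewrite -!addrA; congr (_ + _)%R; rewrite addrC.
by case: t1 => [|z t] //=; rewrite rev_cons last_rcons.
Qed.

Lemma path_sum_cut red phi x t : path (fun x y => red x y == phi x + phi y)%R x t ->
  path_sum red x t = (phi x + phi (last x t))%R.
Proof.
elim: t x => [|y t IH] x /=; first by rewrite M2.
by case/andP=> /eqP-> /IH->; rewrite addrA -[(phi x + _ + _)%R]addrA M2 addr0.
Qed.

Lemma cycle_sum_cut red phi q : cycle (fun x y => red x y == phi x + phi y)%R q ->
  cycle_sum red q = 0%R.
Proof. by case: q => //= x t /path_sum_cut->; rewrite last_rcons M2. Qed.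

Lemma cycle_sumD red phi c q :
  (cycle_sum (fun x y => red x y + phi x + phi y + c) q = cycle_sum red q + c *+ size q)%R.
Proof.
case: q => [|x t] /=; first by rewrite add0r.
have E z s : path_sum (fun x y => red x y + phi x + phi y + c)%R z s =
    (path_sum red z s + phi z + phi (last z s) + c *+ size s)%R.
  elim: s z => [|w s IH] z /=; first by rewrite add0r M2 add0r.
  rewrite IH mulrS -[RHS]addr0 -(M2 (phi w)); ring.
by rewrite E last_rcons size_rcons -[RHS]addr0 -(M2 (phi x)); ring.
Qed.

Lemma sum_next red q : uniq q ->
  (\sum_(x <- q) red x (next q x))%R = cycle_sum red q.
Proof.
case: q => [|x t] uq; first by rewrite big_nil.
have E d y s z : path_sum red y (rcons s z) =
    (\sum_(0 <= i < (size s).+1) red (nth d (y :: s) i) (nth z s i))%R.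
  elim: s y => [|w s IH] y; first by rewrite big_nat1 /= addr0.
  by rewrite big_nat_recl //= IH.
rewrite (big_nth x) [RHS]/= (E x) !big_mkord; apply: eq_bigr => i _.
congr red; rewrite next_nth mem_nth // index_uniq //.
Qed.

End ColouredCycles.

(** * Cuts between robust sets *)

Section Cuts.
Variables (V : finType) (e : rel V) (M : comNzRingType).
Hypotheses (e_sym : symmetric e) (e_irr : irreflexive e).
Hypothesis M2 : forall x : M, (x + x = 0)%R.
Variables (m r : nat).
Hypotheses (m0 : 0 < m) (mr : m <= 2 ^ r) (jm : joined e m).
Implicit Types (A B D T : {set V}) (red : V -> V -> M) (phi : V -> M).

Definition robust A := expands e A m /\ 200 * ((r + 2) * m) <= #|A|.

(** The common sum [h] is left arbitrary so that the property survives adding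
    [phi x + phi y + c]. *)
Definition balanced red := [/\ forall x y, red x y = red y x & exists h, forall q,
  uniq q -> cycle e q -> (forall x, x \in q) -> cycle_sum red q = h].

Lemma balancedD red phi c : balanced red ->
  balanced (fun x y => red x y + phi x + phi y + c)%R.
Proof.
move=> [rC [h hh]]; split=> [x y|]; first by rewrite rC; ring.
exists (h + c *+ #|V|)%R => q uq cq aq; rewrite cycle_sumD // hh //.
by rewrite -(card_uniqP uq); congr (_ + _ *+ _)%R; apply: eq_card => x; rewrite aq.
Qed.

Lemma robust_ge A : robust A -> 2 * m <= #|A|.
Proof. by case=> _; apply: leq_trans; nia. Qed.

Lemma cut_of_hamilton red A1 A2 B1 B2 : balanced red ->
    robust A1 -> robust A2 -> robust B1 -> robust B2 ->
    [disjoint A1 & A2] -> [disjoint B1 & B2] -> [disjoint A1 :|: A2 & B1 :|: B2] ->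
    (forall x, x \in (A1 :|: A2) :|: (B1 :|: B2)) ->
  exists phi, forall x y, x \in A1 -> y \in B1 -> e x y -> red x y = (phi x + phi y)%R.
Proof.
move=> [rC [h hh]] rA1 rA2 rB1 rB2 dA dB dAB cov.
have := robust_ge rA2; have := robust_ge rB2; move=> gB gA.
have dAB2 : [disjoint A2 & B2].
  by apply: disjointWl (subsetUr A1 A2) _; apply: disjointWr (subsetUr B1 B2) _.
have [||s [t [sA tB est]]] := jm dAB2; try lia.
have con A A' z : robust A -> robust A' -> [disjoint A & A'] -> z \in A' ->
    exists f : V -> seq V, forall a, a \in A ->
    [/\ is_path e (a :: f a), a :: f a =i A :|: A' & last a (f a) = z].
  move=> [ex1 s1] [ex2 s2] d zA.
  have /boolp.choice[f hf] : forall a, exists w, a \in A ->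
    [/\ is_path e (a :: w), a :: w =i A :|: A' & last a w = z].
    move=> a; have [aA|] := boolP (a \in A); last by exists [::].
    have [w hw] := hamilton_connected e_sym m0 mr jm ex1 ex2 s1 s2 d aA zA.
    by exists w.
  by exists f.
have [f hf] := con _ _ s rA1 rA2 dA sA; have [g hg] := con _ _ t rB1 rB2 dB tB.
(* Joining the two paths by [s t] and [x y] gives a Hamilton cycle of sum [h]; the potential on the
   second side absorbs [red s t + h]. *)
exists (fun x => if x \in A1 then path_sum red x (f x)
  else path_sum red x (g x) + red s t + h)%R => x y xA yB exy.
have nyA : y \in A1 = false.
  apply/negbTE/negP=> yA; have yB' : y \in B1 :|: B2 by rewrite inE yB.
  by have := disjointFl dAB yB'; rewrite inE yA.
rewrite xA nyA; have [px Ex lx] := hf x xA; have [py Ey ly] := hg y yB.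
have := hh (rev (x :: f x) ++ y :: g y); rewrite cycle_sum_join // lx ly => <-.
- set a := path_sum _ _ _; set b := path_sum _ _ _.
  rewrite -[LHS]addr0 -(M2 (a + b + red s t)%R); ring.
- rewrite cat_uniq rev_uniq; case/andP: px => _ ->; case/andP: py => _ ->.
  rewrite andbT; apply/hasPn=> z; rewrite Ey => zB /=; rewrite mem_rev Ex.
  by rewrite (disjointFl dAB zB).
- apply: cycle_join => //; by rewrite lx ly.
- by move=> z; rewrite mem_cat mem_rev Ex Ey -in_setU.
Qed.

(** No edge between [T] and [T'] joins a level set of [psi] to its complement. If both are nonempty,
    expansion gives each at least [m] vertices in [T] or in [T']; as these have at least [2 * m]
    vertices, [m] vertices of one in [T] face [m] of the other in [T'], against [joined]. *)
Lemma cut_constant (K : eqType) (psi : V -> K) T T' : robust T -> robust T' -> [disjoint T & T'] ->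
    (forall x y, x \in T -> y \in T' -> e x y -> psi x = psi y) ->
  exists k, forall x, x \in T :|: T' -> psi x = k.
Proof.
move=> rT rT' dT eq; have gT := robust_ge rT; have gT' := robust_ge rT'.
have claim (a b : {set V}) : a \subset T -> b \subset T' -> a :|: b != set0 ->
    nbs e a :&: T' \subset b -> nbs e b :&: T \subset a -> m <= #|a| \/ m <= #|b|.
  move=> sa sb n0 na nb.
  have [|la] := leqP m #|a|; first by left.
  have [|lb] := leqP m #|b|; first by right.
  exfalso.
  have ha : 4 * #|a| <= #|b|.
    have [->|a0] := eqVneq a set0; first by rewrite cards0.
    apply: leq_trans (rT'.1 _ a0 (ltnW la)) (subset_leq_card _).
    by apply: subset_trans na; apply: subsetDl.
  have hb : 4 * #|b| <= #|a|.
    have [->|b0] := eqVneq b set0; first by rewrite cards0.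
    apply: leq_trans (rT.1 _ b0 (ltnW lb)) (subset_leq_card _).
    by apply: subset_trans nb; apply: subsetDl.
  move: n0; rewrite -card_gt0; have := (leq_card_setU a b).1; lia.
have /set0Pn[x0 x0T] : T != set0 by rewrite -card_gt0; lia.
exists (psi x0).
pose a := [set x in T | psi x == psi x0]; pose b := [set x in T' | psi x == psi x0].
have sa : a \subset T by apply/subsetP=> x; rewrite inE => /andP[].
have sb : b \subset T' by apply/subsetP=> x; rewrite inE => /andP[].
have eq' x y : x \in T' -> y \in T -> e x y -> psi x = psi y.
  by rewrite e_sym => h1 h2 h3; rewrite (eq y x).
have c1 : m <= #|a| \/ m <= #|b|.
  apply: claim => //.
  - by apply/set0Pn; exists x0; rewrite !inE x0T eqxx.
  - apply/subsetP=> y /setIP[]; rewrite !inE => /exists_inP[x]; rewrite inE => /andP[xT /eqP <-] exy yT.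
    by rewrite yT (eq x y) ?eqxx.
  - apply/subsetP=> y /setIP[]; rewrite !inE => /exists_inP[x]; rewrite inE => /andP[xT /eqP <-] exy yT.
    by rewrite yT (eq' x y) ?eqxx.
have no1 x y : x \in a -> y \in T' :\: b -> e x y -> False.
  rewrite !inE => /andP[xT /eqP px] /andP[+ yT] exy.
  by rewrite yT -(eq x y) // px eqxx.
have no2 x y : x \in b -> y \in T :\: a -> e x y -> False.
  rewrite !inE => /andP[xT /eqP px] /andP[+ yT] exy.
  by rewrite yT -(eq' x y) // px eqxx.
suff E : (T :\: a) :|: (T' :\: b) = set0.
  move=> x xT; apply/eqP/negPn/negP=> nx.
  have : x \in (T :\: a) :|: (T' :\: b).
    by move: xT; rewrite !inE (negbTE nx) !andbF.
  by rewrite E inE.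
apply/eqP/negPn/negP=> n0.
have c2 : m <= #|T :\: a| \/ m <= #|T' :\: b|.
  apply: claim => //; try exact: subsetDl.
  - apply/subsetP=> y /setIP[]; rewrite !inE => /exists_inP[x xa exy] yT.
    rewrite yT andbT; apply/negP=> /andP[_ py].
    by apply: (no2 y x _ xa); rewrite ?inE ?yT // e_sym.
  - apply/subsetP=> y /setIP[]; rewrite !inE => /exists_inP[x xa exy] yT.
    rewrite yT andbT; apply/negP=> /andP[_ py].
    by apply: (no1 y x _ xa); rewrite ?inE ?yT // e_sym.
have ca := cardsDS sa; have cb := cardsDS sb.
have la := subset_leq_card sa; have lb := subset_leq_card sb.
have dj1 : [disjoint a & T' :\: b].
  by apply: disjointWl sa _; apply: disjointWr (subsetDl _ _) _.
have dj2 : [disjoint b & T :\: a].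
  by rewrite disjoint_sym; apply: disjointWl (subsetDl _ _) _; apply: disjointWr sb _.
have n1 : ~ (m <= #|a| /\ m <= #|T' :\: b|).
  by move=> [h1 h2]; have [x [y [xa yb exy]]] := jm dj1 h1 h2; apply: no1 exy.
have n2 : ~ (m <= #|b| /\ m <= #|T :\: a|).
  by move=> [h1 h2]; have [x [y [xa yb exy]]] := jm dj2 h1 h2; apply: no2 exy.
lia.
Qed.

(** * Gluing the cuts of a five-part labelling *)

Section Glue.
Variable chi : V -> nat.
Definition part i := [set x | chi x == i].
(* D leaves room for moving one or two vertices to other parts. *)
Hypothesis robust_part : forall i A D, i < 5 -> #|D| <= 2 ->
  part i :\: D \subset A -> robust A.

(** Parts 3 and 4 are set aside to serve as [A2] and [B2] in [cut_of_hamilton]; the free parts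
    supply [A1] and [B1]. *)
Definition free := [set x | chi x < 3].
Hypothesis chi5 : forall x, chi x < 5.

Lemma robust_part0 i A : i < 5 -> part i \subset A -> robust A.
Proof. by move=> i5 sA; apply: (robust_part (D := set0) i5); rewrite ?cards0 ?setD0. Qed.

Lemma part_free i : i < 3 -> exists2 j, j < 3 & part j \subset free :\: part i.
Proof.
move=> i3; exists (i == 0 : nat); first by case: (i == 0).
apply/subsetP=> x; rewrite !inE => /eqP->; case: i i3 => [|i] //=.
Qed.

(** [X] is moved to the side of [part i] and [Y] to the other side, which stays robust because it
    contains nearly all of another free part. *)
Lemma cut_part rd i X Y : balanced rd -> i < 3 -> #|X :|: Y| <= 2 -> [disjoint X & Y] ->
  exists psi, forall x y, x \in (part i :\: (X :|: Y)) :|: X ->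
    y \in (free :\: part i) :\: (X :|: Y) :|: Y -> e x y -> rd x y = (psi x + psi y)%R.
Proof.
move=> bal i3 D2 dXY; set D := X :|: Y in D2 *.
have [j j3 sj] := part_free i3.
have sub4 k : part k :\: D \subset part k :\: D by [].
apply: (cut_of_hamilton (A2 := part 3 :\: D) (B2 := part 4 :\: D) bal).
- by apply: (robust_part (ltn_trans i3 _) D2) => //; apply: subsetUl.
- exact: (robust_part _ D2 (sub4 3)).
- apply: (robust_part (ltn_trans j3 _) D2) => //.
  by apply: subset_trans (subsetUl _ _); apply: setSD.
- exact: (robust_part _ D2 (sub4 4)).
- rewrite -setI_eq0; apply/eqP/setP=> x; rewrite !inE.
  by case: eqP => [->|_]; case: (x \in X); case: (x \in Y); rewrite ?andbF //= (ltn_eqF i3).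
- rewrite -setI_eq0; apply/eqP/setP=> x; rewrite !inE.
  case: (eqVneq (chi x) 4) => [->|_]; last by rewrite !andbF.
  by case: (x \in X); case: (x \in Y); rewrite ?andbF.
- rewrite -setI_eq0; apply/eqP/setP=> x; rewrite !inE.
  have := disjointFr dXY (x := x).
  case: (x \in X) => [/(_ isT)->|_]; first by rewrite !andbF.
  case: (x \in Y); rewrite /= ?andbF //= ?orbF.
  case: (chi x =P i) => [->|] /=; first by rewrite (ltn_eqF (ltn_trans i3 (isT : 3 < 4))).
  by move=> _; case: eqP => [->|].
- move=> x; rewrite !inE; have := chi5 x.
  case: (x \in X); case: (x \in Y); rewrite /= ?orbT //=.
  case: (chi x == i) => //=; move: (chi x) => n; lia.
Qed.

Lemma cut_part0 rd i : balanced rd -> i < 3 ->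
  exists psi, forall x y, x \in part i -> y \in free :\: part i -> e x y ->
    rd x y = (psi x + psi y)%R.
Proof.
move=> bal i3; have [||psi h] := cut_part (X := set0) (Y := set0) bal i3.
- by rewrite setU0 cards0.
- by rewrite -setI_eq0 setI0.
by exists psi => x y hx hy; apply: h; rewrite !setU0 !setD0.
Qed.

Lemma disjoint_part i j : i != j -> [disjoint part i & part j].
Proof.
move=> ij; rewrite -setI_eq0; apply/eqP/setP=> x; rewrite !inE.
by case: eqP => [->|]; rewrite ?(negbTE ij).
Qed.

Lemma normalize_parts rd : balanced rd -> exists phi c, forall x y,
  x \in free -> y \in free -> chi x != chi y -> e x y ->
  (rd x y + phi x + phi y + c)%R = 0%R.
Proof.
move=> bal; have [phi hphi] := cut_part0 (i := 0) bal isT.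
pose r1 x y := (rd x y + phi x + phi y + 0)%R.
have b1 : balanced r1 := balancedD phi 0%R bal.
have r10 x y : x \in part 0 -> y \in free :\: part 0 -> e x y -> r1 x y = 0%R.
  move=> hx hy exy; rewrite /r1 (hphi x y) //.
  transitivity ((phi x + phi x) + (phi y + phi y))%R; first by ring.
  by rewrite !M2.
have P i x : x \in part i -> (chi x = i) by rewrite inE => /eqP.
have rp i : i < 5 -> robust (part i) by move=> i5; apply: robust_part0 i5 _.
have side i : 0 < i < 3 -> exists k (psi : V -> M),
   forall x y, x \in part i -> y \in free :\: part i :\: part 0 -> e x y ->
     r1 x y = (k + psi y)%R.
  case/andP=> i0 i3; have [psi hpsi] := cut_part0 b1 i3.
  have [||||k hk] := @cut_constant _ psi (part 0) (part i).
  - exact: rp.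
  - by apply: rp; apply: ltn_trans i3 _.
  - by apply: disjoint_part; rewrite eq_sym -lt0n.
  - move=> x y hx hy exy; have := r10 x y hx; rewrite (proj1 b1) (hpsi y x) //.
    + rewrite !inE (P _ _ hy) i3 -lt0n i0 => /(_ isT exy) E.
      by rewrite -[LHS]add0r -E addrAC -addrA M2 addr0.
    + by rewrite !inE (P _ _ hx) eq_sym -lt0n i0.
    + by rewrite e_sym.
  exists k, psi => x y hx /setDP[hy _] exy; rewrite (hpsi x y) // (hk x) //.
  by rewrite inE hx orbT.
have [k [psi hpsi]] := side 1 isT; have [k' [theta htheta]] := side 2 isT.
have rC : forall x y, r1 x y = r1 y x by case: b1.
(* Between parts 1 and 2 the colour [r1] is a function of either endpoint alone, hence constant. *)
have [c hc] : exists c, forall x, x \in part 1 :|: part 2 ->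
    (if chi x == 1 then k' + theta x else k + psi x)%R = c.
  apply: cut_constant; [exact: rp|exact: rp|exact: disjoint_part|].
  move=> x y hx hy exy; rewrite (P _ _ hx) (P _ _ hy) /=.
  rewrite -(hpsi x y) // ?inE ?(P _ _ hy) // rC; apply: esym; apply: htheta => //.
    by rewrite !inE (P _ _ hx).
  by rewrite e_sym.
have r12 x y : x \in part 1 -> y \in part 2 -> e x y -> r1 x y = c.
  move=> hx hy exy; rewrite (hpsi x y) // ?inE ?(P _ _ hy) //.
  by rewrite -(hc y) ?inE ?(P _ _ hy).
(* Adding [c] everywhere, and again at vertices of [part 0], kills the constant between parts 1 and
   2 and keeps the edges from [part 0] to them at 0. *)
exists (fun x => if chi x == 0 then phi x + c else phi x)%R, c.
have main x y : x \in free -> y \in free -> chi x < chi y -> e x y ->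
    (rd x y + (if chi x == 0 then phi x + c else phi x) +
       (if chi y == 0 then phi y + c else phi y) + c)%R = 0%R.
  move=> fx fy lt exy; have fy' : chi y < 3 by move: fy; rewrite inE.
  have -> : (chi y == 0) = false by rewrite (gtn_eqF (leq_ltn_trans _ lt)).
  have [x0|x0] := eqVneq (chi x) 0.
    have := r10 x y; rewrite !inE x0 fy' (gtn_eqF (leq_ltn_trans _ lt)) // => /(_ isT isT exy).
    move=> E; transitivity (r1 x y + (c + c))%R; first by rewrite /r1; ring.
    by rewrite E M2 addr0.
  have := r12 x y; rewrite !inE.
  have -> : chi x == 1 by move: x0 lt fy'; case: (chi x) => [|[|n]] //; lia.
  have -> : chi y == 2 by move: x0 lt fy'; move: (chi x) (chi y) => a b; lia.
  by move=> /(_ isT isT exy); rewrite /r1 addr0 => ->; exact: M2.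
move=> x y fx fy; rewrite neq_ltn => /orP[lt|lt] exy; first exact: main.
have [rdC _] := bal; rewrite e_sym in exy.
by apply: etrans (main y x fy fx lt exy); rewrite rdC; ring.
Qed.

Definition normalized rd := forall x y, x \in free -> y \in free ->
  chi x != chi y -> e x y -> rd x y = 0%R :> M.

(** As [rd] vanishes between different free parts, the potential of the cut is constant on the
    unmoved free vertices; adding that constant everywhere preserves the cut and makes it 0
    there. *)
Lemma normalized_cut rd i X Y : balanced rd -> normalized rd -> i < 3 ->
    #|X :|: Y| <= 2 -> [disjoint X & Y] ->
  exists psi, [/\
    forall x z, x \in X -> z \in (free :\: part i) :\: (X :|: Y) -> e x z -> rd x z = psi x,
    forall y z, y \in Y -> z \in part i :\: (X :|: Y) -> e y z -> rd y z = psi y &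
    forall x y, x \in X -> y \in Y -> e x y -> rd x y = (psi x + psi y)%R].
Proof.
move=> bal nrm i3 D2 dXY; have [psi hpsi] := cut_part bal i3 D2 dXY.
set D := X :|: Y in D2 hpsi *.
have [j j3 sj] := part_free i3.
have [] := @cut_constant _ psi (part i :\: D) (free :\: part i :\: D).
- exact: (robust_part (ltn_trans i3 _) D2).
- by apply: (robust_part (ltn_trans j3 _) D2) => //; apply: setSD.
- rewrite -setI_eq0; apply/eqP/setP=> x; rewrite !inE.
  by case: (chi x == i); rewrite /= ?andbF.
- move=> x y hx hy exy; have := hpsi x y; rewrite inE hx inE hy => /(_ isT isT exy).
  rewrite nrm //; last 3 first.
  + by move: hx; rewrite !inE => /andP[_ /eqP->].
  + by move: hy; rewrite !inE => /and3P[].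
  + by move: hx hy; rewrite !inE => /andP[_ /eqP->] /and3P[_ + _]; rewrite eq_sym.
  by move=> E; rewrite -[LHS]addr0 E addrA M2 add0r.
move=> k hk; have [rC _] := bal.
exists (fun x => psi x + k)%R; split.
- move=> x z xX zf exz; rewrite (hpsi x z) //; [|by rewrite inE xX orbT|by rewrite inE zf].
  by rewrite (hk z) // inE zf orbT.
- move=> y z yY zp eyz; rewrite rC (hpsi z y) //; [|by rewrite inE zp|by rewrite inE yY orbT|by rewrite e_sym].
  by rewrite [LHS]addrC (hk z) // inE zp.
move=> x y xX yY exy; rewrite (hpsi x y) //; [|by rewrite inE xX orbT|by rewrite inE yY orbT].
by rewrite -[LHS]addr0 -(M2 k); ring.
Qed.

(* Moving x and y to two different parts yields cuts that are constant on the
   other vertices, so every vertex sees a single colour on its edges to free. *)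
Lemma cut_of_normalized rd : balanced rd -> normalized rd ->
  exists phi, forall x y, e x y -> rd x y = (phi x + phi y)%R.
Proof.
move=> bal nrm; have [rC _] := bal.
have irr x z : e x z -> z != x by apply: contraTneq => ->; rewrite e_irr.
(* Some free part [i] contains neither [z] nor [z']; with [x] moved to its side both edges cross the
   cut. *)
have const x z z' : z \in free -> z' \in free -> e x z -> e x z' -> rd x z = rd x z'.
  move=> zf z'f exz exz'.
  have [i i3 /andP[ni ni']] : exists2 i, i < 3 & (chi z != i) && (chi z' != i).
    move: zf z'f; rewrite !inE; case: (chi z) => [|[|[|n]]] //; case: (chi z') => [|[|[|n']]] // _ _;
      by [exists 0|exists 1|exists 2].
  have [||psi [h _ _]] := @normalized_cut rd i [set x] set0 bal nrm i3.
  - by rewrite setU0 cards1.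
  - by rewrite -setI_eq0 setI0.
  move: zf z'f; rewrite !inE => zf z'f.
  by rewrite !(h x) ?inE ?eqxx ?orbF ?irr ?ni ?ni'.
have nbr x i D : i < 3 -> #|D| <= 2 -> exists2 z, z \in part i :\: D & e x z.
  move=> i3 D2; have [ex _] := robust_part (ltn_trans i3 (isT : 3 < 5)) D2 (subxx _).
  have x0 : [set x] != set0 by apply/set0Pn; exists x; rewrite inE.
  have := ex _ x0; rewrite cards1 => /(_ m0) h.
  have : 0 < #|nbs e [set x] :&: (part i :\: D) :\: [set x]| by apply: leq_trans h.
  rewrite card_gt0 => /set0Pn[z /setDP[/setIP[zn zp] _]]; exists z => //.
  by move: zn; rewrite inE => /exists_inP[w]; rewrite inE => /eqP->.
(* The default 0 is never reached: by [nbr] every vertex has a neighbour in [free]. *)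
pose phi x := if [pick z in free | e x z] is Some z then rd x z else 0%R.
have phiE x z : z \in free -> e x z -> rd x z = phi x.
  move=> zf exz; rewrite /phi; case: pickP => [w /andP[wf exw]|/(_ z)].
    exact: const.
  by rewrite zf exz.
have sf i : i < 3 -> part i \subset free.
  by move=> i3; apply/subsetP=> x; rewrite !inE => /eqP->.
exists phi => x y exy.
have yx := irr _ _ exy.
have D2 : #|[set x] :|: [set y]| <= 2 by rewrite cards2; case: (_ != _).
have dj : [disjoint [set x] & [set y]].
  by rewrite disjoints1 inE eq_sym.
(* With [x] on the side of [part 0] and [y] opposite, a neighbour of [x] in [part 1] and one of [y]
   in [part 0] identify [psi] with [phi] at [x] and [y]. *)
have [psi [h1 h2 h3]] := normalized_cut (i := 0) bal nrm isT D2 dj.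
rewrite (h3 x y) ?set11 //; congr (_ + _)%R.
  have [z zp exz] := nbr x 1 _ isT D2.
  have zf := subsetP (sf 1 isT) _ (subsetP (subsetDl _ _) _ zp).
  rewrite -(phiE x z) // (h1 x z) ?set11 //.
  by move: zp; rewrite !inE => /andP[-> /eqP->].
have [z zp eyz] := nbr y 0 _ isT D2.
have zf := subsetP (sf 0 isT) _ (subsetP (subsetDl _ _) _ zp).
by rewrite -(phiE y z) // (h2 y z) ?set11.
Qed.

Lemma cut_of_vanishing red : (forall x y, red x y = red y x) -> odd #|V| ->
    (forall q, uniq q -> cycle e q -> (forall x, x \in q) -> cycle_sum red q = 0%R) ->
  exists phi, forall x y, e x y -> red x y = (phi x + phi y)%R.
Proof.
move=> rC oV h0; have bal : balanced red by split=> //; exists 0%R.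
have [phi [c hc]] := normalize_parts bal.
have [psi hpsi] := cut_of_normalized (balancedD phi c bal) hc.
have [exT sT] : robust setT by apply: (robust_part0 (i := 0)).
have [q [uq cq aq]] := hamilton_cycle e_sym m0 mr jm exT sT.
have qa x : x \in q by rewrite aq inE.
have sq : size q = #|V|.
  by rewrite -(card_uniqP uq); apply: eq_card => x; rewrite qa.
(* On a Hamilton cycle the corrected colouring is a cut, of sum 0, yet its sum is [c] taken an odd
   number of times. *)
have c0 : c = 0%R.
  have := cycle_sumD M2 red phi c q; rewrite h0 // add0r sq -(odd_double_half #|V|) oV.
  rewrite mulrnDr -mul2n mulrnA mulr2n M2 mul0rn addr0 => E.
  rewrite -[LHS]/(c *+ true)%R -E.
  apply: (cycle_sum_cut M2 (phi := psi)); apply: sub_cycle cq => x y exy.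
  by rewrite (hpsi x y) //; apply/eqP.
exists (fun x => psi x + phi x)%R => x y /hpsi; rewrite c0 addr0 => E.
transitivity (red x y + (phi x + phi x) + (phi y + phi y))%R; first by rewrite !M2 !addr0.
transitivity (red x y + phi x + phi y + phi x + phi y)%R; first by ring.
by rewrite E; ring.
Qed.

End Glue.

End Cuts.

(** * Labellings *)

Section Labelling.
Variable V : finType.

(** As [(5 / 6) ^ 4 < 1 / 2], the eighth power of [x / y] is at most [1 / 2], and its 24th at most
    [1 / 8]. For 9 and 10 the hypothesis reads [486 <= 500]. *)
Lemma exp_ratio_aux x y d k : 6 * x ^ 2 <= 5 * y ^ 2 -> x <= y -> 24 * d <= k ->
  x ^ k * 8 ^ d <= y ^ k.
Proof.
move=> xy le /subnK <-; rewrite (expnD x (k - _)) (expnD y (k - _)) -mulnA; apply: leq_mul.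
  by case: (k - 24 * d) => // j; rewrite leq_exp2r.
have base : x ^ 8 * 2 <= y ^ 8.
  have h : (6 * x ^ 2) ^ 4 <= (5 * y ^ 2) ^ 4 by rewrite leq_exp2r.
  rewrite (expnMn 6) (expnMn 5) -!expnM in h.
  rewrite -(@leq_pmul2l (5 ^ 4)) //; apply: leq_trans h.
  by rewrite mulnCA [leqRHS]mulnC leq_mul2l; apply/orP; right.
have base3 : x ^ 24 * 8 <= y ^ 24.
  have h : (x ^ 8 * 2) ^ 3 <= (y ^ 8) ^ 3 by rewrite leq_exp2r.
  by rewrite expnMn -!expnM in h.
have [->|d0] := posnP d; first by rewrite muln0 !expn0.
by rewrite !(expnM _ 24) -expnMn leq_exp2r.
Qed.

Lemma exp_ratio d k : 24 * d <= k -> 9 ^ k * 8 ^ d <= 10 ^ k.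
Proof. exact: exp_ratio_aux. Qed.

(* Markov's inequality for the weight 2 ^ #{w in N | f w != i}, whose mean over
   all f is (9 / 5) ^ #|N|. *)
Lemma card_rare_label (N : {set V}) (i : 'I_5) d : 24 * d <= #|N| ->
  #|[set f : {ffun V -> 'I_5} | #|[set w in N | f w == i]| < d]| * 4 ^ d <= 5 ^ #|V|.
Proof.
move=> dN; set B := [set f | _].
pose F w j := if w \in N then (if j == i then 1 else 2) else 1.
have tot : (\sum_(f : {ffun V -> 'I_5}) \prod_w F w (f w)) * 5 ^ #|N| = 9 ^ #|N| * 5 ^ #|V|.
  rewrite -(bigA_distr_bigA F).
  have E w : \sum_(j < 5) F w j = if w \in N then 9 else 5.
    rewrite /F; case: (w \in N); last by rewrite sum_nat_const card_ord muln1.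
    rewrite (bigD1 i) //= eqxx (eq_bigr (fun=> 2)) => [|j /negbTE->] //.
    have := cardC1 i; rewrite card_ord => E; rewrite sum_nat_const.
    by rewrite (eq_card (B := predC1 i)) ?E // => j; rewrite !inE.
  rewrite (eq_bigr _ (fun w _ => E w)) (bigID (mem N)) /=.
  rewrite (eq_bigr (fun=> 9)) => [|w ->] //; rewrite prod_nat_const.
  rewrite [X in _ * X * _ = _](eq_bigr (fun=> 5)) => [|w /negbTE->] //.
  rewrite prod_nat_const -mulnA -expnD; congr (_ * 5 ^ _).
  by rewrite addnC -(cardC (mem N)).
have low : #|B| * 2 ^ (#|N| - d) <= \sum_(f : {ffun V -> 'I_5}) \prod_w F w (f w).
  rewrite (bigID (mem B)) /=; apply: leq_trans (leq_addr _ _).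
  rewrite -sum_nat_const; apply: leq_sum => f; rewrite inE => fd.
  rewrite (bigID (mem N)) /= [X in _ <= _ * X]big1 => [|w /negbTE]; last by rewrite /F => ->.
  rewrite muln1 (bigID (fun w => f w == i)) /= big1 ?mul1n => [|w /andP[wN fi]]; last by rewrite /F wN fi.
  rewrite (eq_bigr (fun=> 2)) => [|w /andP[wN /negbTE nf]]; last by rewrite /F wN nf.
  rewrite prod_nat_const leq_exp2l //.
  have -> : #|[pred w | (w \in N) && (f w != i)]| = #|N :\: [set w in N | f w == i]|.
    by apply: eq_card => w; rewrite !inE; case: (w \in N); rewrite ?andbT ?andbF.
  rewrite cardsDS; last by apply/subsetP=> w; rewrite inE => /andP[].
  by rewrite leq_sub2l // ltnW.
(* The two bounds give [#|B| <= 2 ^ d * (9 / 10) ^ #|N| * 5 ^ #|V|], and the middle factor is at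
   most [8 ^ - d]. *)
rewrite -(@leq_pmul2l (10 ^ #|N|)) ?expn_gt0 //.
have dN' : d <= #|N| by lia.
have -> : 10 ^ #|N| * (#|B| * 4 ^ d) = #|B| * 2 ^ (#|N| - d) * 5 ^ #|N| * 8 ^ d.
  have -> : 10 ^ #|N| = 2 ^ (#|N| - d) * 2 ^ d * 5 ^ #|N|.
    by rewrite -expnD subnK // -expnMn.
  have -> : 8 ^ d = 2 ^ d * 4 ^ d by rewrite -expnMn.
  by nia.
apply: leq_trans (_ : 9 ^ #|N| * 5 ^ #|V| * 8 ^ d <= _).
  by rewrite leq_mul2r -tot leq_mul2r low !orbT.
by rewrite mulnAC leq_mul2r exp_ratio // orbT.
Qed.

(** Union bound over the [5 * #|V|] pairs of a vertex and a label. *)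
Lemma labelling_exists (N : V -> {set V}) d : (forall v, 24 * d <= #|N v|) ->
  5 * #|V| < 4 ^ d ->
  exists f : V -> 'I_5, forall v i, d <= #|[set w in N v | f w == i]|.
Proof.
move=> dN lt.
pose B (u : V * 'I_5) := [set f : {ffun V -> 'I_5} | #|[set w in N u.1 | f w == u.2]| < d].
have cB : #|\bigcup_u B u| < #|{: {ffun V -> 'I_5}}|.
  rewrite card_ffun card_ord -(@ltn_pmul2r (4 ^ d)) ?expn_gt0 //.
  apply: leq_ltn_trans (_ : 5 * #|V| * 5 ^ #|V| < _); last first.
    by rewrite mulnC ltn_pmul2l ?expn_gt0.
  apply: leq_trans (_ : (\sum_u #|B u|) * 4 ^ d <= _).
    rewrite leq_mul2r; apply/orP; right.
    apply: (big_ind2 (fun (X : {set {ffun V -> 'I_5}}) n => #|X| <= n)); rewrite ?cards0 //.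
    move=> X x Y y h1 h2; apply: leq_trans (leq_card_setU _ _) _; exact: leq_add.
  rewrite big_distrl /=; apply: leq_trans (_ : \sum_(u : V * 'I_5) 5 ^ #|V| <= _).
    by apply: leq_sum => u _; apply: card_rare_label.
  by rewrite sum_nat_const card_prod card_ord [#|V| * 5]mulnC.
have [f nf] : exists f, f \notin \bigcup_u B u.
  apply/existsP; rewrite -negb_forall; apply: contraTN cB => /forallP h.
  by rewrite -leqNgt; apply/subset_leq_card/subsetP=> f _; apply: h.
exists f => v i; rewrite leqNgt; apply: contra nf => lt'.
by apply/bigcupP; exists (v, i) => //; rewrite inE.
Qed.

End Labelling.

(** * Jumbled graphs *)

Section GraphCounting.
Variables (V : finType) (G : sgraph V).
Implicit Types (X Y Z A : {set V}).
Local Notation e := (adj G).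

Lemma degree_sum_le X Z k : X \subset Z ->
    (forall v, v \in X -> k <= #|[set w in Z | e v w]|) ->
  #|X| * k <= 2 * num_edges_in G Z.
Proof.
move=> /subsetP sXZ hk; pose EZ := [set s in edges G | s \subset Z].
pose P (u : V * V) := [&& u.1 \in Z, u.2 \in Z & e u.1 u.2].
apply: leq_trans (_ : \sum_(v in X) \sum_(w | (w \in Z) && e v w) 1 <= _).
  rewrite -sum_nat_const; apply: leq_sum => v vX; rewrite sum1_card.
  by apply: leq_trans (hk v vX) _; rewrite cardsE.
apply: leq_trans (_ : \sum_(v in Z) \sum_(w | (w \in Z) && e v w) 1 <= _).
  rewrite [leqRHS](bigID (mem X)) /=; apply: leq_trans (leq_addr _ _).
  rewrite [leqRHS](eq_bigl (mem X)) // => v /=.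
  by case: (boolP (v \in X)) => [/sXZ->|]; rewrite ?andbF.
rewrite pair_big_dep /= (eq_bigl P) => [|u] //.
rewrite (partition_big (fun u : V * V => [set u.1; u.2]) (mem EZ)) => [|u /and3P[u1 u2 uu]] /=; last first.
  rewrite inE; apply/andP; split.
    by apply/imset2P; exists u.1 u.2; rewrite ?inE.
  by apply/subsetP=> z; rewrite !inE => /orP[/eqP->|/eqP->].
rewrite mulnC -[num_edges_in G Z]/(#|EZ|) -sum_nat_const; apply: leq_sum => s _.
rewrite sum1_card.
case: (pickP [pred u | P u && ([set u.1; u.2] == s)]) => [[a b] /= /andP[_ /eqP Es]|no]; last first.
  by rewrite (eq_card0 (A := _)) // => u; have := no u.
have sub : [pred u | P u && ([set u.1; u.2] == s)] \subset [set (a, b); (b, a)].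
  apply/subsetP=> -[c d]; rewrite !inE /= => /andP[/and3P[_ _ /= cd] /eqP].
  rewrite -{}Es => /setP E; have := E c; have := E d; have := E a; have := E b.
  have cd' : c != d by apply: contraTneq cd => ->; rewrite adj_irr.
  rewrite !inE !eqxx ?orbT /= => h1 h2; rewrite !xpair_eqE.
  move=> /esym/orP[/eqP Ed|/eqP Ed] /esym/orP[/eqP Ec|/eqP Ec]; subst; rewrite ?eqxx ?orbT //; by rewrite eqxx in cd'.
apply: leq_trans (subset_leq_card sub) _; rewrite cards2; by case: (_ != _).
Qed.

Lemma num_edges_disjoint X Y :
    (forall x y, x \in X -> y \in Y -> e x y = false) ->
  num_edges_in G (X :|: Y) <= num_edges_in G X + num_edges_in G Y.
Proof.
move=> no; apply: leq_trans (leq_card_setU _ _).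
apply/subset_leq_card/subsetP=> s; rewrite !inE => /andP[sE /subsetP sXY]; rewrite sE /=.
have no' x y : x \in Y -> y \in X -> e x y = false by rewrite adj_sym => h1 h2; apply: no.
move: sE sXY => /imset2P[x y _]; rewrite inE => /andP[_ exy] -> sXY.
have := sXY x; have := sXY y; rewrite !inE !eqxx orbT => /(_ isT) hy /(_ isT) hx.
have sub Z : x \in Z -> y \in Z -> [set x; y] \subset Z.
  by move=> xZ yZ; apply/subsetP=> z; rewrite !inE => /orP[/eqP->|/eqP->].
case/orP: hx => hx; case/orP: hy => hy.
- by rewrite sub.
- by move: exy; rewrite no.
- by move: exy; rewrite no'.
- by rewrite (sub Y) ?orbT.
Qed.

End GraphCounting.

(** * Joining, expansion and size from jumbledness *)

Section Jumbled.
Variables (R : realType) (V : finType) (G : sgraph V) (p beta : R).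
Hypothesis jG : jumbled G p beta.
Implicit Types (X Y Z A : {set V}).
Local Notation e := (adj G).
Local Open Scope ring_scope.

Lemma bin2R k : 'C(k, 2)%:R = k%:R * (k%:R - 1) / 2 :> R.
Proof.
elim: k => [|k IH]; first by rewrite mul0r mul0r.
by rewrite binS bin1 natrD IH -natr1; field.
Qed.

Lemma jumbled_upper Z : 2 * (num_edges_in G Z)%:R <= p * #|Z|%:R ^+ 2 + 2 * beta * #|Z|%:R.
Proof.
case: jG => /andP[p0 _] b1 /(_ Z); rewrite bin2R ler_norml => /andP[_].
have : 0 <= #|Z|%:R :> R by []. nra.
Qed.

(** Without edges between sets of sizes [x] and [y], jumbledness gives
    [p * x * y <= 2 * beta * (x + y)], whereas [x, y >= m] gives [2 * x * y >= m * (x + y)]. *)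
Lemma jumbled_joined m : 4 * beta < p * m%:R -> joined e m.
Proof.
case: jG => /andP[p0 p1] b1 hj pm X Y dXY mX mY; apply: contrapT => no.
have noE x y : x \in X -> y \in Y -> e x y = false.
  by move=> xX yY; apply/negP=> exy; apply: no; exists x, y.
have := num_edges_disjoint noE; rewrite -(ler_nat R) natrD => le.
have cXY : #|X :|: Y| = (#|X| + #|Y|)%N.
  by rewrite cardsU; move: dXY; rewrite -setI_eq0 => /eqP->; rewrite cards0 subn0.
have := hj X; have := hj Y; have := hj (X :|: Y).
rewrite !bin2R cXY natrD !ler_norml => /andP[+ _] /andP[_ +] /andP[_ +].
move: le mX mY; rewrite -!(ler_nat R).
move: (num_edges_in _ _)%:R => a; move: (num_edges_in _ _)%:R => b.
move: (num_edges_in _ _)%:R => c; move: #|X|%:R #|Y|%:R => x y le mx my h1 h2 h3.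
have m0 : 0 <= m%:R :> R by [].
move: (m%:R : R) pm mx my m0 => M pm mx my M0.
have M1 : 0 < M by nra.
have : p * (x * y) <= 2 * beta * (x + y) by nra.
have : 4 * beta * (x + y) < p * M * (x + y) by rewrite ltr_pM2r //; lra.
have : p * (M * (x + y)) <= p * (2 * (x * y)) by rewrite ler_pM2l //; nra.
nra.
Qed.

Section Degrees.
Variables (A : {set V}) (d m : nat).
Hypothesis dA : forall v, (d <= #|[set w in A | e v w]|)%N.

(** If expansion fails, [X :|: Y] has at most [5 * #|X|] vertices but contains all edges from [X] to
    [A]: too many for the upper bound on edges. *)
Lemma jumbled_expands : 25 * p * m%:R + 10 * beta < d%:R -> expands e A m.
Proof.
case: (jG) => /andP[p0 p1] b1 _ hd X X0 Xm; rewrite leqNgt; apply/negP=> lt.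
set Y := (nbs e X :&: A) :\: X in lt.
have h : (#|X| * d <= 2 * num_edges_in G (X :|: Y))%N.
  apply: degree_sum_le => [|v vX]; first exact: subsetUl.
  apply: leq_trans (dA v) (subset_leq_card _); apply/subsetP=> w.
  rewrite !inE => /andP[wA evw]; rewrite evw andbT wA andbT.
  case: (w \in X) => //=; apply/exists_inP; by exists v.
have cZ : (#|X :|: Y| <= 5 * #|X|)%N.
  by have := (leq_card_setU X Y).1; move: lt; lia.
have x0 : (0 < #|X|)%N by rewrite card_gt0.
have up := jumbled_upper (X :|: Y).
move: h cZ x0 Xm; rewrite -!(ler_nat R) !natrM.
move: up; move: (num_edges_in _ _)%:R => E; move: #|X :|: Y|%:R (ler0n R #|X :|: Y|) => z z0.
move: #|X|%:R => x up h cZ x0 xm.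
have xp : 0 < x by exact: lt_le_trans ltr01 x0.
have : z ^+ 2 <= 25 * x ^+ 2 by nra.
have : 0 <= m%:R :> R by [].
move: (m%:R : R) (d%:R : R) hd h xm => M D hd h xm M0 zz.
have h1 : x * D <= 25 * p * x ^+ 2 + 10 * beta * x by nra.
have h2 : x * D <= x * (25 * p * x + 10 * beta) by rewrite (le_trans h1) // le_eqVlt; apply/orP; left; apply/eqP; ring.
rewrite ler_pM2l // in h2.
have : p * x <= p * M by rewrite ler_pM2l.
lra.
Qed.

Lemma jumbled_card : (0 < #|V|)%N -> (0 < d)%N ->
  d%:R <= p * #|A|%:R + 2 * beta.
Proof.
move=> /card_gt0P[v _] d0.
have A0 : (0 < #|A|)%N.
  apply: leq_trans (leq_trans d0 (dA v)) (subset_leq_card _).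
  by apply/subsetP=> w; rewrite inE => /andP[].
have := degree_sum_le (subxx A) (fun v _ => dA v); rewrite -(ler_nat R) !natrM.
move: A0; rewrite -(ltr0n R); have := jumbled_upper A.
move: (num_edges_in _ _)%:R #|A|%:R (d%:R : R) => E x D h1 x0 h2.
have : x * D <= x * (p * x + 2 * beta).
  by rewrite (le_trans h2) // (le_trans h1) // le_eqVlt; apply/orP; left; apply/eqP; ring.
by rewrite ler_pM2l.
Qed.

End Degrees.

End Jumbled.

(** * The cycle space *)

Section CycleSpace.
Variables (V : finType) (G : sgraph V).
Implicit Types (c : seq V) (x y : V).
Local Open Scope ring_scope.

Lemma next_next c x : (2 < size c)%N -> uniq c -> x \in c -> next c (next c x) != x.
Proof.
move=> sc uc xc; have [i c' Ec] := rot_to xc.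
rewrite -!(next_rot i uc) Ec.
have := uc; rewrite -(rot_uniq i) Ec.
have : (2 < size (x :: c'))%N by rewrite -Ec size_rot.
case: c' {Ec} => [|y [|z s]] //= _; rewrite !inE !negb_or.
move=> /andP[/and3P[xy xz xs] _].
by rewrite !eqxx (eq_sym y x) (negbTE xy) ?eqxx eq_sym.
Qed.

(** A cycle has length at least 3, so its edges are distinct and nothing cancels modulo 2. *)
Lemma edge_vec_cycle c : is_cycle G c ->
  edge_vec G (cycle_edges c) = \sum_(x <- c) edge_vec G (set1 [set x; next c x]).
Proof.
case/and3P=> sc uc cc; apply/ffunP=> s; rewrite sum_ffunE ffunE.
under eq_bigr => x _ do rewrite ffunE inE.
have inj x y : x \in c -> y \in c -> [set x; next c x] = [set y; next c y] -> x = y.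
  move=> xc yc /setP E; apply/eqP; apply: contraT => xy.
  have := E x; have := E y; rewrite !inE !eqxx (negbTE xy) (eq_sym y x) (negbTE xy) /=.
  move=> /eqP Ey /esym/eqP Ex.
  by have := next_next sc uc xc; rewrite -Ey -Ex eqxx.
case: (boolP (val s \in cycle_edges c)) => [/imsetP[x xc Es]|ns].
  rewrite (bigD1_seq x) //= Es eqxx big1_seq ?addr0 // => y /andP[yx yc].
  case: eqP => // E; case/eqP: yx; exact/esym/(inj _ _ xc yc).
rewrite big1_seq // => x /andP[_ xc]; case: eqP => // Es.
by case/negP: ns; rewrite Es; apply: imset_f.
Qed.

Lemma cycle_space_len_full :
    (forall red : V -> V -> 'F_2, (forall x y, red x y = red y x) ->
      (forall c, is_cycle G c -> size c = #|V| -> cycle_sum red c = 0) ->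
      exists phi, forall x y, adj G x y -> red x y = phi x + phi y) ->
  cycle_space_len G #|V| = cycle_space G.
Proof.
move=> hred; apply/eqP; rewrite eqEsubv; apply/andP; split.
  apply: sub_span => v; rewrite !mem_filter => /andP[/asboolP[c /andP[hc _] ->] ->].
  by rewrite andbT; apply/asboolP; exists c.
apply/span_subvP=> v; rewrite mem_filter => /andP[/asboolP[c hc ->] _].
set U := cycle_space_len G #|V|.
have M2 (x : 'F_2) : x + x = 0 by apply/val_inj; case: x => -[|[|]].
(* [f] is linear and vanishes exactly on [U]; its coordinate [e0] on single edges is the colouring
   [red]. *)
pose f (w : edge_space G) := w - projv U w.
have fD (I : Type) (s : seq I) (F : I -> edge_space G) :
    f (\sum_(i <- s) F i) = \sum_(i <- s) f (F i).
  by rewrite /f linear_sum sumrB.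
suff f0 : f (edge_vec G (cycle_edges c)) = 0.
  by rewrite -(subrK (projv U (edge_vec G (cycle_edges c))) (edge_vec _ _)) -/(f _) f0 add0r memv_proj.
apply/ffunP=> e0; rewrite [RHS]ffunE.
pose red x y : 'F_2 := f (edge_vec G [set [set x; y]]) e0.
have fE c' : is_cycle G c' -> f (edge_vec G (cycle_edges c')) e0 = cycle_sum red c'.
  move=> hc'; have /and3P[_ uc' _] := hc'.
  by rewrite edge_vec_cycle // fD sum_ffunE -(sum_next red uc').
have [||phi hphi] := hred red.
- by move=> x y; rewrite /red setUC.
- move=> c' hc' sc'; rewrite -fE // /f projv_id ?subrr ?ffunE //.
  apply: memv_span; rewrite mem_filter mem_enum andbT; apply/asboolP.
  by exists c' => //; rewrite hc' sc' eqxx.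
rewrite fE //; apply: (cycle_sum_cut M2 (phi := phi)).
case/and3P: hc => _ _ cc; apply: sub_cycle cc => x y exy.
by apply/eqP/hphi.
Qed.

End CycleSpace.

(** * Numerical estimates and the choice of parameters *)

Section Conclusion.
Local Open Scope ring_scope.

Lemma min_degree_le (V : finType) (G : sgraph V) v : (min_degree G <= degree G v)%N.
Proof.
rewrite /min_degree; have := mem_index_enum v.
elim: (index_enum V) => [//|w s IH]; rewrite inE big_cons => /orP[/eqP->|/IH].
  exact: geq_minl.
by apply: leq_trans; apply: geq_minr.
Qed.

(** [d] is the degree into each class that remains after removing at most two vertices, whence
    [d + 2] in the labelling conditions. *)
Lemma cycle_space_of_jumbled (R : realType) (V : finType) (G : sgraph V) (p beta : R)
    (m r d : nat) :
    jumbled G p beta -> odd #|V| -> (0 < m)%N -> (m <= 2 ^ r)%N ->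
    4 * beta < p * m%:R -> 25 * p * m%:R + 10 * beta < d%:R ->
    2 * beta + p * (200 * ((r + 2) * m))%:R <= d%:R ->
    (forall v, (24 * (d + 2) <= degree G v)%N) -> (5 * #|V| < 4 ^ (d + 2))%N ->
  cycle_space_len G #|V| = cycle_space G.
Proof.
move=> jG oV m0 mr h1 h2 h3 hdeg hV.
have jm := jumbled_joined jG h1.
have V0 : (0 < #|V|)%N by case: #|V| oV.
have [f hf] := labelling_exists hdeg hV.
have [/andP[p0 _] b1 _] := jG.
have rob i (A D : {set V}) : (i < 5)%N -> (#|D| <= 2)%N ->
    part (fun x => f x : nat) i :\: D \subset A -> robust (adj G) m r A.
  move=> i5 D2 /subsetP sA.
  have dA v : (d <= #|[set w in A | adj G v w]|)%N.
    rewrite -(leq_add2r 2); apply: leq_trans (hf v (Ordinal i5)) _.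
    have sub : [set w in [set w | adj G v w] | f w == Ordinal i5] \subset
        [set w in A | adj G v w] :|: D.
      apply/subsetP=> w; rewrite !inE => /andP[vw /eqP fw]; rewrite vw andbT.
      by case: (boolP (w \in D)) => wD; rewrite ?orbT // sA // !inE wD fw eqxx.
    apply: leq_trans (subset_leq_card sub) _.
    by apply: leq_trans (leq_card_setU _ _) _; rewrite leq_add2l.
  have d0 : (0 < d)%N.
    rewrite -(ltr0n R); apply: lt_trans h2.
    have : 0 <= p * m%:R by rewrite mulr_ge0 // ltW.
    lra.
  split; first exact: (jumbled_expands jG dA h2).
  have := jumbled_card jG dA V0 d0 => hA.
  rewrite -(ler_nat R) -(ler_pM2l p0); lra.
apply: cycle_space_len_full => red rC hred.
have F2 (x : 'F_2) : x + x = 0 by apply/val_inj; case: x => -[|[|]].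
have V3 : (2 < #|V|)%N.
  have [v _] := card_gt0P V0; have := hdeg v.
  have : (degree G v <= #|V|)%N by apply: max_card.
  lia.
apply: (cut_of_vanishing (@adj_sym _ G) (@adj_irr _ G) F2 m0 mr jm rob) => //.
move=> q uq cq aq.
have sq : size q = #|V|.
  by rewrite -(card_uniqP uq); apply: eq_card => x; rewrite aq.
by apply: hred => //; rewrite /is_cycle sq V3 uq.
Qed.

(** From [1 - 1 / 2 <= expR (- 1 / 2)]; it yields both [expR 1 <= 4] and [1 / 2 <= ln 2]. *)
Lemma expR_half (R : realType) : expR (2^-1) <= 2 :> R.
Proof.
have := expR_ge1Dx (- 2^-1 : R); rewrite expRN => h.
have e0 := expR_gt0 (2^-1 : R).
have h' : 2^-1 <= (expR (2^-1))^-1 :> R by apply: le_trans h; lra.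
by rewrite -[leRHS]invrK -[leLHS]invrK lef_pV2 ?posrE ?invr_gt0.
Qed.

Lemma ln_ge1 (R : realType) n : (4 <= n)%N -> 1 <= ln n%:R :> R.
Proof.
move=> n4; have h := expR_half R; have e0 := expR_gt0 (2^-1 : R).
have E : expR 1 = expR (2^-1) * expR (2^-1) :> R.
  by rewrite -expRD; congr expR; lra.
rewrite -[leLHS](expRK (1 : R)) ler_ln ?posrE ?expR_gt0 ?ltr0n //; last by lia.
have : 4 <= n%:R :> R by rewrite ler_nat.
rewrite E; nra.
Qed.

Lemma trunc_log_le (R : realType) n : (0 < n)%N -> (trunc_log 2 n)%:R <= 2 * ln n%:R :> R.
Proof.
move=> n0; have h : (2 ^ trunc_log 2 n <= n)%N by apply: trunc_logP.
have : ln ((2 ^ trunc_log 2 n)%:R : R) <= ln n%:R.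
  by rewrite ler_ln ?posrE ?ltr0n ?expn_gt0 // ler_nat.
rewrite natrX lnXn ?ltr0n // -[ln 2 *+ _]mulr_natr.
have l2 : 2^-1 <= ln 2 :> R.
  by rewrite -[leLHS]expRK ler_ln ?posrE ?expR_gt0 ?expR_half.
have t0 : 0 <= (trunc_log 2 n)%:R :> R by [].
have : 2^-1 * (trunc_log 2 n)%:R <= ln 2 * (trunc_log 2 n)%:R :> R by rewrite ler_wpM2r.
lra.
Qed.

End Conclusion.

Local Open Scope ring_scope.

Theorem corollary1p4 (R : realType) :
  exists (eps C : R) (n0 : nat), 0 < eps /\ 1 < C /\
    forall n : nat, odd n -> (n0 <= n)%N ->
    forall p beta : R,
      C * ln n%:R / n%:R <= p ->
      beta <= eps * n%:R * p / ln n%:R ->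
    forall (V : finType) (G : sgraph V),
      #|V| = n ->
      jumbled G p beta ->
      (1 - eps) * n%:R * p <= (min_degree G)%:R ->
      cycle_space_len G n = cycle_space G.
Proof.
exists (1000^-1 * 1000^-1), 1000, 4%N; split; first by rewrite mulr_gt0 ?invr_gt0.
split; first by lra.
move=> n on n4 p beta hp hb V G cV jG hd.
have [/andP[p0 p1] b1 _] := jG.
have L1 := ln_ge1 R n4; set L := ln n%:R in L1 hp hb.
have npos : (0 < n)%N by apply: leq_trans n4.
have n0 : 0 < n%:R :> R by rewrite ltr0n.
have L0 : 0 < L by exact: lt_le_trans ltr01 L1.
have hp' : 1000 * L <= n%:R * p by rewrite [leRHS]mulrC -ler_pdivrMr.
have hb' : 1000 * (1000 * (beta * L)) <= n%:R * p.
  have : beta * L <= 1000^-1 * 1000^-1 * (n%:R * p) by rewrite -ler_pdivlMr // mulrA.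
  lra.
have hb'' : 1000 * (1000 * beta) <= n%:R * p.
  apply: le_trans hb'; rewrite !ler_pM2l // ler_peMr //; lra.
set w := n%:R * p in hp' hb' hb''.
(* [d] is about one hundredth of [n p], so that [24 * (d + 2)] fits below the minimum degree; [m] is
   the least integer with [4 * beta < p * m], and then [p * m <= 5 * beta] as [p < 1 <= beta]. *)
pose d := (Num.truncn (w / 100)).+1; pose m := (Num.truncn (4 * beta / p)).+1.
pose r := (trunc_log 2 n).+1.
have w0 : 0 <= w / 100 by lra.
have /andP[d1 d2] := truncn_itv w0.
have q0 : 0 <= 4 * beta / p by rewrite divr_ge0 // ?ltW //; lra.
have /andP[m1 m2] := truncn_itv q0.
have dE : d%:R = (Num.truncn (w / 100))%:R + 1 :> R by rewrite natr1.
have mE : m%:R = (Num.truncn (4 * beta / p))%:R + 1 :> R by rewrite natr1.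
have pm1 : 4 * beta < p * m%:R by rewrite [ltRHS]mulrC -ltr_pdivrMr.
have pm2 : p * m%:R <= 5 * beta.
  rewrite mE mulrDr mulr1.
  have : p * (Num.truncn (4 * beta / p))%:R <= 4 * beta by rewrite mulrC -ler_pdivlMr.
  lra.
have rE : r%:R <= 2 * L + 1 :> R by rewrite /r -natr1 lerD2r trunc_log_le.
have nr : (n < 2 ^ r)%N by apply: trunc_log_ltn.
have mn : (m <= n)%N.
  rewrite -(ler_nat R) -(ler_pM2l p0) (le_trans pm2) // [leRHS]mulrC -/w; lra.
have rd : (r <= d)%N by rewrite -(ler_nat R) (le_trans rE) //; lra.
rewrite -cV; apply: (cycle_space_of_jumbled (m := m) (r := r) (d := d) jG).
- by rewrite cV.
- by [].
- exact: leq_trans mn (ltnW nr).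
- exact: pm1.
- lra.
(* With [L >= 1] the size term is at most [200 * 5 * beta * 5 * L], which is at most [w / 200]. *)
- rewrite !natrM natrD.
  have : p * (m%:R * (r%:R + 2)) <= 5 * beta * (2 * L + 3).
    rewrite mulrA; apply: ler_pM => //; last by move: rE; clear; lra.
      by rewrite mulr_ge0 // ltW.
    by rewrite addr_ge0.
  have : beta * 1 <= beta * L by rewrite ler_pM2l // (lt_le_trans ltr01).
  lra.
- move=> v; apply: leq_trans (min_degree_le G v).
  rewrite -(ler_nat R) (le_trans _ hd) // natrM natrD -mulrA -/w; lra.
(* Here [n < 2 ^ r <= 4 ^ d], and [5 < 4 ^ 2]. *)
rewrite cV expnD; apply: leq_ltn_trans (_ : (5 * 4 ^ d < _)%N); last first.
  by rewrite mulnC ltn_pmul2l ?expn_gt0.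
rewrite leq_mul2l /=; apply: leq_trans (ltnW nr) _.
by apply: leq_trans (_ : (2 ^ d <= _)%N); rewrite ?leq_exp2l ?leq_exp2r.
Qed.
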